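(* Let $n\ge2$ and let $\Omega$ be a bounded open Lipschitz subset of $\mathbb R^n$. Let $\gamma_1\in]-\infty,n-1[$, $\gamma_2,\gamma_3\in\mathbb R$. Then the following statements hold. (i) If $(K,\mu)\in\mathcal K_{\gamma_1,\gamma_2,\gamma_3}(\partial\Omega)\times L^\infty(\partial\Omega)$, then the function $K(x,\cdot)\mu(\cdot)$ is integrable in $\partial\Omega$ for all $x\in\partial\Omega$, and the function $u[\partial\Omega,K,\mu]$ from $\partial\Omega$ to $\mathbb C$ defined by $$u[\partial\Omega,K,\mu](x)=\int_{\partial\Omega}K(x,y)\mu(y)\,d\sigma_y\qquad\forall x\in\partial\Omega$$ is continuous. Moreover, the bilinear map from $\mathcal K_{\gamma_1,\gamma_2,\gamma_3}(\partial\Omega)\times L^\infty(\partial\Omega)$ to $C^0(\partial\Omega)$ which takes $(K,\mu)$ to $u[\partial\Omega,K,\mu]$ is continuous. (ii) If $\gamma_1\in[n-2,n-1[$, $\gamma_2\in]n-1,+\infty[$, $\gamma_3\in]0,1]$, $(n-1)-\gamma_2+\gamma_3\in]0,1]$, then the bilinear map from $\mathcal K_{\gamma_1,\gamma_2,\gamma_3}(\partial\Omega)\times L^\infty(\partial\Omega)$ to $C^{0,\min\{(n-1)-\gamma_1,(n-1)-\gamma_2+\gamma_3\}}(\partial\Omega)$ which takes $(K,\mu)$ to $u[\partial\Omega,K,\mu]$ is continuous. (iii) If $\gamma_1\in[n-2,n-1[$, $\gamma_2=n-1$, $\gamma_3\in]0,1]$, then the bilinear map from $\mathcal K_{\gamma_1,\gamma_2,\gamma_3}(\partial\Omega)\times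 L^\infty(\partial\Omega)$ to $C^{0,\max\{r^{(n-1)-\gamma_1},\,\omega_{\gamma_3}(r)\}}(\partial\Omega)$ which takes $(K,\mu)$ to $u[\partial\Omega,K,\mu]$ is continuous.
   Context: For $G\subseteq\mathbb R^n$ put $\Delta_G=\{(x,y)\in G\times G:x=y\}$; $\mathbb B_n(x,R)$ is the open ball. For a nonempty bounded $G\subseteq\mathbb R^n$ and $\gamma_1,\gamma_2,\gamma_3\in\mathbb R$, $\mathcal K_{\gamma_1,\gamma_2,\gamma_3}(G)$ is the (Banach) space of continuous functions $K:(G\times G)\setminus\Delta_G\to\mathbb C$ with $$\|K\|_{\mathcal K_{\gamma_1,\gamma_2,\gamma_3}(G)}=\sup_{x,y\in G,\,x\ne y}|x-y|^{\gamma_1}|K(x,y)|+\sup\Bigl\{\tfrac{|x'-y|^{\gamma_2}}{|x'-x''|^{\gamma_3}}|K(x',y)-K(x'',y)|:x',x''\in G,\,x'\ne x'',\,y\in G\setminus\mathbb B_n(x',2|x'-x''|)\Bigr\}<+\infty .$$ For $\theta\in]0,1]$ put $r_\theta=e^{-1/\theta}$, $\omega_\theta(r)=r^\theta|\ln r|$ for $r\in]0,r_\theta]$, $\omega_\theta(r)=r_\theta^\theta|\ln r_\theta|$ for $r>r_\theta$. For a nondecreasing $\omega:]0,+\infty[\to]0,+\infty[$ with $\lim_{r\to0^+}\omega(r)=0$ and $\sup_{0<r<1}r/\omega(r)<\infty$, $C^{0,\omega(\cdot)}(\partial\Omega)$ is the space of continuous $f:\partial\Omega\to\mathbb C$ with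 norm $\sup|f|+\sup_{x\ne y}|f(x)-f(y)|/\omega(|x-y|)<\infty$; $C^{0,\alpha}$ means $\omega(r)=r^\alpha$. $C^0(\partial\Omega)$ has the sup norm; $d\sigma$ is the area element and $L^\infty(\partial\Omega)$ is taken with respect to it. *)

(* Defs.v *)
From HB Require Import structures.
From mathcomp Require Import all_boot all_order all_algebra.
From mathcomp Require Import all_classical all_reals all_analysis.
From mathcomp.real_closed Require Export complex.

Set Implicit Arguments.
Unset Strict Implicit.
Unset Printing Implicit Defensive.

Import Order.TTheory GRing.Theory Num.Theory.
Import numFieldNormedType.Exports.

Local Open Scope classical_set_scope.
Local Open Scope ring_scope.

(* The library norm of 'rV[R]_n is the max norm; it induces the usual topology
   and the usual bounded sets, but distances below are Euclidean. *)
Section euclidean.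
Context {R : realType} {n : nat}.

Definition enorm (x : 'rV[R]_n) : R := Num.sqrt (\sum_i x 0 i ^+ 2).

Definition eball (x : 'rV[R]_n) (r : R) : set 'rV[R]_n :=
  [set y | enorm (y - x) < r].

Definition boundary (A : set 'rV[R]_n) : set 'rV[R]_n := closure A `\` interior A.

End euclidean.

(* Supremum in [0, +oo] of a set of nonnegative reals; it is 0 on set0, whereas
   ereal_sup set0 = -oo. *)
Definition sup0 {R : realType} (A : set R) : \bar R :=
  ereal_sup ([set 0%E] `|` [set r%:E | r in A]).

Section hausdorff.
Context {R : realType} {n : nat}.
Local Open Scope ereal_scope.

(* Volume of the unit ball of R^m, i.e. pi^(m/2) / Gamma(m/2 + 1). *)
Fixpoint unit_ball_volume (m : nat) : R :=
  match m with
  | 0%N => 1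
  | 1%N => 2
  | k.+2 => (2 * pi / k.+2%:R * unit_ball_volume k)%R
  end.

Definition ediam (U : set 'rV[R]_n) : \bar R :=
  ereal_sup [set (enorm (x - y)%R)%:E | x in U & y in U].

(* set0 gets weight 0 also for m = 0. *)
Definition hausdorff_weight (m : nat) (U : set 'rV[R]_n) : \bar R :=
  if `[< U = set0 >] then 0
  else (unit_ball_volume m)%:E * (ediam U * (2^-1)%:E) ^+ m.

Definition hausdorff_content (m : nat) (delta : R) (A : set 'rV[R]_n) : \bar R :=
  ereal_inf [set \sum_(k <oo) hausdorff_weight m (U k) |
    U in [set U : (set 'rV[R]_n)^nat |
      A `<=` \bigcup_k U k /\ forall k, ediam (U k) <= delta%:E]].

(* m-dimensional Hausdorff outer measure of R^n, normalized so as to agree with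
   the m-dimensional area of m-dimensional Lipschitz submanifolds. *)
Definition hausdorff (m : nat) (A : set 'rV[R]_n) : \bar R :=
  ereal_sup [set hausdorff_content m delta A | delta in [set d : R | (0 < d)%R]].

Lemma unit_ball_volume_ge0 m : (0 <= unit_ball_volume m)%R.
Proof.
suff : (0 <= unit_ball_volume m)%R /\ (0 <= unit_ball_volume m.+1)%R by case.
elim: m => [|m [h0 h1]]; first by split => //=; rewrite ?ler01 ?ler0n.
split => //; apply: mulr_ge0 => //; apply: divr_ge0; last exact: ler0n.
by apply: mulr_ge0; [exact: ler0n|exact: pi_ge0].
Qed.

Lemma hausdorff_weight_ge0 m U : 0 <= hausdorff_weight m U.
Proof.
rewrite /hausdorff_weight; case: asboolP => // /eqP/set0P[x Ux].
apply: mule_ge0; first by rewrite lee_fin unit_ball_volume_ge0.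
apply: expe_ge0; apply: mule_ge0; last by rewrite lee_fin invr_ge0 ler0n.
apply: le_trans (_ : (enorm (x - x)%R)%:E <= _).
  by rewrite lee_fin sqrtr_ge0.
by apply: ereal_sup_ubound; exists x => //; exists x.
Qed.

Lemma hausdorff_weight0 m : hausdorff_weight m set0 = 0.
Proof. by rewrite /hausdorff_weight; case: asboolP. Qed.

Let gauge m (delta : R) (U : set 'rV[R]_n) : \bar R :=
  if ediam U <= delta%:E then hausdorff_weight m U else +oo.

Let gauge_ge0 m delta U : 0 <= gauge m delta U.
Proof. by rewrite /gauge; case: ifP => // _; exact: hausdorff_weight_ge0. Qed.

Let gauge0 m delta : gauge m delta set0 = 0.
Proof.
rewrite /gauge hausdorff_weight0; case: ifPn => //.
rewrite /ediam (_ : [set _ | _ in _ & _ in _] = set0) ?ereal_sup0 ?leNye//.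
by apply/seteqP; split => // y [].
Qed.

Let hausdorff_contentE m delta :
  hausdorff_content m delta = mu_ext (T := g_sigma_algebraType
    [set: set 'rV[R]_n]) (gauge m delta).
Proof.
apply/funext => A; apply/eqP; rewrite eq_le; apply/andP; split.
- apply: le_ereal_inf_tmp => _ [U [_ AU] <-].
  have [Ud|] := pselect (forall k, ediam (U k) <= delta%:E).
    apply: ereal_inf_lbound; exists U => //.
    by apply: eq_eseriesr => k _; rewrite /gauge Ud.
  move=> /existsNP[k /negP/negbTE Uk].
  rewrite (@eseries_pinfty _ _ _ k) ?leey//; last by rewrite /gauge Uk.
  by move=> j _; rewrite -ltNye (lt_le_trans _ (gauge_ge0 _ _ _)).
- apply: le_ereal_inf_tmp => _ [U [AU Ud] <-].
  apply: ereal_inf_lbound; exists U.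
    by split => // k; apply: sub_sigma_algebra.
  by apply: eq_eseriesr => k _; rewrite /gauge Ud.
Qed.

Let hausdorff0 m : hausdorff m set0 = 0.
Proof.
apply/eqP; rewrite eq_le; apply/andP; split.
  apply: ge_ereal_sup => _ [d _ <-].
  by rewrite hausdorff_contentE mu_ext0.
apply: ereal_sup_ubound; exists 1%R => /=; first exact: ltr01.
by rewrite hausdorff_contentE mu_ext0.
Qed.

Let hausdorff_ge0 m A : 0 <= hausdorff m A.
Proof.
apply: le_trans (_ : hausdorff_content m 1 A <= _).
  by rewrite hausdorff_contentE; exact: mu_ext_ge0.
by apply: ereal_sup_ubound; exists 1%R => //=; exact: ltr01.
Qed.

Let le_hausdorff m : {homo hausdorff m : A B / A `<=` B >-> A <= B}.
Proof.
move=> A B AB; apply: ge_ereal_sup => _ [d d0 <-].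
apply: le_trans (_ : hausdorff_content m d B <= _).
  by rewrite hausdorff_contentE; exact: le_mu_ext.
by apply: ereal_sup_ubound; exists d.
Qed.

Let hausdorff_sigma_subadditive m : sigma_subadditive (hausdorff m).
Proof.
move=> F; apply: ge_ereal_sup => _ [d d0 <-].
apply: le_trans (_ : \sum_(i <oo) hausdorff_content m d (F i) <= _).
  by rewrite hausdorff_contentE; apply: mu_ext_sigma_subadditive.
apply: lee_nneseries => [i _ _|i _].
  by rewrite hausdorff_contentE; exact: mu_ext_ge0.
by apply: ereal_sup_ubound; exists d.
Qed.

HB.instance Definition _ (m : nat) := isOuterMeasure.Build R 'rV[R]_n
  (hausdorff m) (hausdorff0 m) (hausdorff_ge0 m) (@le_hausdorff m)
  (@hausdorff_sigma_subadditive m).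

End hausdorff.

Section spaces.
Context {R : realType} {n : nat}.
Local Notation E := 'rV[R]_n.
Local Notation C := R[i].
Implicit Types (G : set E).

(* The area element: the (n-1)-dimensional Hausdorff measure, on the (complete)
   sigma-algebra of its Caratheodory measurable sets. *)
Let H : {outer_measure set E -> \bar R} := @hausdorff R n n.-1.

Definition area : {measure set (caratheodory_type H) -> \bar R} :=
  (H : set (caratheodory_type H) -> \bar R).

Definition cmeasurable G (f : E -> C) : Prop :=
  measurable_fun (G : set (caratheodory_type H))
    (fun y => complex.Re (f y)) /\
  measurable_fun (G : set (caratheodory_type H))
    (fun y => complex.Im (f y)).

Definition cintegrable G (f : E -> C) : Prop :=
  area.-integrable G (fun y => (complex.Re (f y))%:E) /\
  area.-integrable G (fun y => (complex.Im (f y))%:E).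

Definition cintegral G (f : E -> C) : C :=
  ((\int[area]_(y in G) complex.Re (f y)) +i* (\int[area]_(y in G) complex.Im (f y)))%C.

(* A linear space of functions on some set G is given by its elements,
   represented by functions that are defined everywhere but whose values off
   the domain are irrelevant, and by its norm; two representatives of the same
   element are at distance 0. *)
Record nspace (F : Type) := NSpace {
  elements :> F -> Prop;
  nspace_norm : F -> \bar R }.

Definition kernel_norm (g1 g2 g3 : R) G (K : E -> E -> C) : \bar R :=
  (sup0 [set r | exists x y, [/\ G x, G y, x != y &
      r = enorm (x - y) `^ g1 * Normc.normc (K x y)]]%R +
   sup0 [set r | exists x' x'' y, [/\ G x', G x'', x' != x'',
      (G `\` eball x' (2 * enorm (x' - x''))) y &
      r = enorm (x' - y) `^ g2 / enorm (x' - x'') `^ g3 *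
          Normc.normc (K x' y - K x'' y)]]%R)%E.

Definition kernel_space (g1 g2 g3 : R) G : nspace (E -> E -> C) := NSpace
  [set K | {within (G `*` G) `\` [set p | p.1 = p.2],
              continuous (fun p : E * E => K p.1 p.2 : C^o)} /\
           (kernel_norm g1 g2 g3 G K < +oo)%E]
  (kernel_norm g1 g2 g3 G).

Definition linfty_norm G (f : E -> C) : \bar R :=
  ('N[area]_+oo [(fun y => (Normc.normc (f y))%:E) \_ G])%E.

Definition linfty_space G : nspace (E -> C) := NSpace
  [set f | cmeasurable G f /\ (linfty_norm G f < +oo)%E]
  (linfty_norm G).

Definition sup_norm G (f : E -> C) : \bar R :=
  sup0 [set Normc.normc (f x) | x in G].

(* Used for compact G only, where the sup norm is finite. *)
Definition C0_space G : nspace (E -> C) := NSpace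
  [set f | {within G, continuous (f : E -> C^o)}]
  (sup_norm G).

Definition holder_norm (omega : R -> R) G (f : E -> C) : \bar R :=
  (sup_norm G f +
   sup0 [set r | exists x y, [/\ G x, G y, x != y &
      r = Normc.normc (f x - f y) / omega (enorm (x - y))]]%R)%E.

Definition holder_space (omega : R -> R) G : nspace (E -> C) := NSpace
  [set f | {within G, continuous (f : E -> C^o)} /\
           (holder_norm omega G f < +oo)%E]
  (holder_norm omega G).

(* B is a bilinear map from X x Y to Z, where the elements of Z are functions
   on G, and it is continuous at every point of X x Y. *)
Definition continuous_bilinear G (X : nspace (E -> E -> C))
    (Y Z : nspace (E -> C)) (B : (E -> E -> C) -> (E -> C) -> E -> C) : Prop :=
  [/\ forall K mu, X K -> Y mu -> Z (B K mu),
      forall (c : C) K1 K2 mu, X K1 -> X K2 -> Y mu -> forall x, G x ->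
        B (fun x y => c * K1 x y + K2 x y) mu x = c * B K1 mu x + B K2 mu x,
      forall (c : C) K mu1 mu2, X K -> Y mu1 -> Y mu2 -> forall x, G x ->
        B K (fun y => c * mu1 y + mu2 y) x = c * B K mu1 x + B K mu2 x &
      forall K0 mu0, X K0 -> Y mu0 -> forall e : R, 0 < e ->
        exists2 d : R, 0 < d & forall K mu, X K -> Y mu ->
          (nspace_norm X (fun x y => (K x y - K0 x y)%R) < d%:E)%E ->
          (nspace_norm Y (fun y => (mu y - mu0 y)%R) < d%:E)%E ->
          (nspace_norm Z (fun x => (B K mu x - B K0 mu0 x)%R) < e%:E)%E].

Definition potential G (K : E -> E -> C) (mu : E -> C) (x : E) : C :=
  cintegral G (fun y => K x y * mu y).

(* Around each boundary point p, in the orthonormal coordinates (eta, t) given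
   by x = p + (eta, t) O, the set Omega is the strict hypograph t < phi eta of a
   Lipschitz function phi. The rows of O form an orthonormal basis of R^n, as
   n.-1 + 1 = n for n > 0. *)
Definition lipschitz_domain (Omega : set E) : Prop :=
  forall p, boundary Omega p ->
  exists (O : 'M[R]_(n.-1 + 1, n)) (r delta L : R) (phi : 'rV[R]_n.-1 -> R),
    [/\ O *m O^T = 1%:M, 0 < r & 0 < delta] /\
    [/\ phi 0 = 0,
        forall eta, eball 0 r eta -> `|phi eta| < delta,
        forall eta eta', eball 0 r eta -> eball 0 r eta' ->
          `|phi eta - phi eta'| <= L * enorm (eta - eta') &
        forall (eta : 'rV[R]_n.-1) (t : R), eball 0 r eta -> `|t| < delta ->
          Omega (p + row_mx eta t%:M *m O) <-> t < phi eta].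

End spaces.

Definition omega_log {R : realType} (theta r : R) : R :=
  let r_theta := expR (- theta^-1) in
  if r <= r_theta then r `^ theta * `|ln r|
  else r_theta `^ theta * `|ln r_theta|.

(* Main.v *)
Require Import Defs.
From HB Require Import structures.
From mathcomp Require Import all_boot all_order all_algebra.
From mathcomp Require Import all_classical all_reals all_analysis.
From mathcomp Require Import finmap measurable_realfun ess_sup_inf ring lra.
Import Order.TTheory GRing.Theory Num.Theory.
Import numFieldNormedType.Exports.
Local Open Scope classical_set_scope.
Local Open Scope ring_scope.

Set Implicit Arguments.
Unset Strict Implicit.
Unset Printing Implicit Defensive.

(** Let m = n - 1.  The boundary G of a bounded Lipschitz domain is upper Ahlfors
    regular: the area of its intersection with a ball of radius s is at most
    C * s ^ m ([lipschitz_boundary_upper_regular]).  Indeed G is compact and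
    locally contained in Lipschitz graphs, and the area of a Lipschitz image of a
    cube is bounded by covering it with the images of small subcubes
    ([hausdorff_lipschitz_image]).  The area element is defined on the sets that
    are measurable for the Hausdorff outer measure in the sense of Caratheodory;
    this outer measure is additive on sets at positive distance, which makes open
    sets measurable ([metric_outer_measure_open]), and so continuous functions
    on G.

    Everything else follows from this regularity by splitting integrals over the
    dyadic shells around a point x ([integral_riesz_dyadic]).  The integral of
    |x - y| ^ (- g) over the part of G in a ball of radius s around x is of order
    s ^ (m - g) if g < m, the integral over the part outside the ball is of order
    s ^ (m - g) if g > m, and of order 1 + ln (d / s) if g = m, where d bounds
    the distances in G.

    The first part of the kernel norm and the first estimate bound the potential
    itself ([potential_bounded]).  For two points x and x', the kernels K x and
    K x' are estimated separately in a ball around x, again by the first part of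
    the kernel norm, and together outside it ([potential_difference]).  Outside
    the ball, continuity off the diagonal and compactness give uniform convergence
    of K x' to K x, hence the continuity of the potential
    ([potential_continuous]).  If instead the radius is 2 |x - x'| then the second
    part of the kernel norm applies outside the ball, and the other two estimates
    give a power as modulus of continuity for g2 > m ([modulus_estimate_power]) and
    a power with a logarithmic factor for g2 = m ([modulus_estimate_log]).  All these bounds are linear in the norms of the
    kernel and of the density, which is what the continuity of the bilinear map
    requires ([continuous_bilinear_of_bound]). *)

(** * The Euclidean norm *)

Section euclidean_norm.
Context {R : realType} {n : nat}.
Implicit Types x y z : 'rV[R]_n.

Lemma enorm_ge0 x : 0 <= enorm x.
Proof. exact: sqrtr_ge0. Qed.

Lemma enorm_sqr x : enorm x ^+ 2 = \sum_i x 0 i ^+ 2.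
Proof. by rewrite sqr_sqrtr//; apply: sumr_ge0 => i _; exact: sqr_ge0. Qed.

Lemma enorm0 : enorm (0 : 'rV[R]_n) = 0.
Proof.
by rewrite /enorm big1 ?sqrtr0// => i _; rewrite mxE expr0n.
Qed.

Lemma enormN x : enorm (- x) = enorm x.
Proof.
by rewrite /enorm; congr Num.sqrt; apply: eq_bigr => i _; rewrite mxE sqrrN.
Qed.

Lemma enormB x y : enorm (x - y) = enorm (y - x).
Proof. by rewrite -enormN opprB. Qed.

Lemma coord_le_enorm x i : `|x 0 i| <= enorm x.
Proof.
rewrite -sqrtr_sqr /enorm ler_sqrt; last first.
  by apply: sumr_ge0 => j _; exact: sqr_ge0.
by rewrite (bigD1 i)//= lerDl; apply: sumr_ge0 => j _; exact: sqr_ge0.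
Qed.

Lemma enorm_gt0 x : (0 < enorm x) = (x != 0).
Proof.
apply/idP/idP; first by apply: contraTneq => ->; rewrite enorm0 ltxx.
move=> x0; rewrite lt_def enorm_ge0 andbT; apply: contra x0 => /eqP x0.
apply/eqP/rowP => i; rewrite mxE; apply/eqP.
by rewrite -normr_le0 -x0 coord_le_enorm.
Qed.

Lemma enorm_sub_gt0 x y : (0 < enorm (x - y)) = (x != y).
Proof. by rewrite enorm_gt0 subr_eq0. Qed.

Lemma Cauchy_Schwarz x y :
  (\sum_i x 0 i * y 0 i) ^+ 2 <= enorm x ^+ 2 * enorm y ^+ 2.
Proof.
set b := \sum_i _; pose a := enorm x ^+ 2; pose c := enorm y ^+ 2.
have [x0|x0] := eqVneq x 0.
  have -> : b = 0 by rewrite /b big1// => i _; rewrite x0 mxE mul0r.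
  by rewrite expr0n/= mulr_ge0 ?sqr_ge0.
have a0 : 0 < a by rewrite exprn_gt0// enorm_gt0.
have : 0 <= \sum_i (a * y 0 i - b * x 0 i) ^+ 2.
  by apply: sumr_ge0 => i _; exact: sqr_ge0.
rewrite (_ : \sum_i _ = a * (a * c - b ^+ 2)); last first.
  have sum_sqr s t : \sum_i (s * y 0 i - t * x 0 i) ^+ 2 =
      s ^+ 2 * (\sum_i y 0 i ^+ 2) +
      (- (2 * s * t) * (\sum_i x 0 i * y 0 i) +
       t ^+ 2 * (\sum_i x 0 i ^+ 2)).
    rewrite !mulr_sumr -!big_split/=; apply: eq_bigr => i _; ring.
  by rewrite sum_sqr -!enorm_sqr -/a -/b -/c; ring.
by rewrite pmulr_rge0// subr_ge0.
Qed.

Lemma enormD x y : enorm (x + y) <= enorm x + enorm y.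
Proof.
rewrite -(@ler_pXn2r _ 2)// ?nnegrE ?addr_ge0 ?enorm_ge0//.
rewrite enorm_sqr (_ : \sum_i _ =
    enorm x ^+ 2 + 2 * (\sum_i x 0 i * y 0 i) + enorm y ^+ 2); last first.
  rewrite !enorm_sqr mulr_sumr -!big_split/=; apply: eq_bigr => i _.
  by rewrite !mxE; ring.
have : \sum_i x 0 i * y 0 i <= enorm x * enorm y.
  apply: le_trans (ler_norm _) _.
  rewrite -(@ler_pXn2r _ 2)// ?nnegrE ?mulr_ge0 ?enorm_ge0//.
  by rewrite real_normK ?num_real// exprMn Cauchy_Schwarz.
by rewrite sqrrD -mulr_natl => h; lra.
Qed.

Lemma ler_enorm_dist y x z : enorm (x - z) <= enorm (x - y) + enorm (y - z).
Proof. by have := enormD (x - y) (y - z); rewrite addrA subrK. Qed.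

Lemma ler_dist_enorm x y : `|enorm x - enorm y| <= enorm (x - y).
Proof.
have h (u v : 'rV[R]_n) : enorm u - enorm v <= enorm (u - v).
  by rewrite lerBlDr; have := enormD (u - v) v; rewrite subrK.
by rewrite ler_norml h andbT lerNl opprB enormB h.
Qed.

Lemma enorm_le_norm x : enorm x <= Num.sqrt n%:R * `|x|.
Proof.
rewrite -(@ler_pXn2r _ 2)// ?nnegrE ?mulr_ge0 ?enorm_ge0 ?sqrtr_ge0//.
rewrite enorm_sqr exprMn sqr_sqrtr//.
have -> : n%:R * `|x| ^+ 2 = \sum_(i < n) `|x| ^+ 2.
  by rewrite sumr_const card_ord mulr_natl.
apply: ler_sum => i _.
rewrite -(real_normK (num_real (x 0 i))) ler_pXn2r ?nnegrE//.
rewrite [leRHS]/Num.norm/= mx_normrE.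
exact: (le_bigmax _ (fun ij : 'I_1 * 'I_n => `|x ij.1 ij.2|) (0, i)).
Qed.

Lemma nbhs_eball x r : 0 < r -> \forall y \near x, enorm (y - x) < r.
Proof.
move=> r0; have c0 : 0 < Num.sqrt n%:R + 1 :> R.
  by rewrite ltr_wpDl// sqrtr_ge0.
apply/(@nbhs_normP _ _ x); exists (r / (Num.sqrt n%:R + 1)) => /=.
  by rewrite divr_gt0.
move=> y /=; rewrite /ball_ /= ltr_pdivlMr// => xy.
rewrite enormB; apply: le_lt_trans xy; apply: le_trans (enorm_le_norm _) _.
by rewrite mulrC ler_wpM2l// lerDl.
Qed.

Lemma enorm_continuous : continuous (@enorm R n).
Proof.
move=> x; apply/(@cvgrPdist_lt _ _ _ (nbhs x)) => e e0.
apply: filterS (nbhs_eball x e0) => y; apply: le_lt_trans.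
by rewrite distrC ler_dist_enorm.
Qed.

Lemma enorm_sub_continuous x : continuous (fun y => enorm (x - y)).
Proof.
move=> /= y; apply: (@continuous_comp _ _ _ (fun y => x - y) enorm).
  by apply: (@cvgB _ _ _ (nbhs y)); [exact: cvg_cst|exact: cvg_id].
exact: enorm_continuous.
Qed.

Lemma eball_center x r : 0 < r -> eball x r x.
Proof. by move=> r0; rewrite /eball/= subrr enorm0. Qed.

Lemma open_eball x r : open (eball x r).
Proof.
rewrite (_ : eball x r = (fun y => enorm (x - y)) @^-1` [set t | t < r]).
  by apply: open_comp; [move=> y _; exact: enorm_sub_continuous|exact: open_lt].
by apply/seteqP; split => y; rewrite /eball/= enormB.
Qed.

End euclidean_norm.

(** * Open sets are measurable for the Hausdorff measure *)

Section metric_outer_measure.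
Context {R : realType} {n : nat}.
Local Notation E := 'rV[R]_n.
Local Open Scope ereal_scope.

Definition separated_sets (A B : set E) : Prop :=
  exists2 d : R, (0 < d)%R &
    forall x y, A x -> B y -> (d <= enorm (x - y))%R.

Definition inner_set (O : set E) (k : nat) : set E :=
  [set x | forall y, ~ O y -> (k.+1%:R^-1 <= enorm (x - y))%R].

Lemma subset_inner_set O k l : (k <= l)%N -> inner_set O k `<=` inner_set O l.
Proof.
move=> kl x Okx y /Okx; apply: le_trans.
by rewrite lef_pV2 ?posrE ?ltr0n// ler_nat.
Qed.

Lemma inner_set_sub O k : inner_set O k `<=` O.
Proof.
move=> x Okx; apply: contrapT => /Okx.
by rewrite subrr enorm0 leNgt invr_gt0 ltr0n.
Qed.

Lemma bigcup_inner_set O : open O -> O = \bigcup_k inner_set O k.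
Proof.
move=> oO; apply/seteqP; split => [x Ox|x [k _]]; last exact: inner_set_sub.
have : nbhs x O by move: oO; rewrite openE; exact.
move=> /nbhs_normP[e /= e0 xeO].
have [k ke] : exists k, (k.+1%:R^-1 < e)%R.
  by exists (Num.truncn e^-1); rewrite invf_plt ?posrE ?ltr0n// truncnS_gt.
exists k => // y Oy; rewrite leNgt; apply/negP => xy; apply: Oy; apply: xeO.
rewrite /ball_/=; apply: le_lt_trans (lt_trans xy ke).
rewrite [leLHS]/Num.norm/= mx_normrE; apply/bigmax_leP; split.
  exact: enorm_ge0.
by move=> [i j] _ /=; rewrite ord1 coord_le_enorm.
Qed.

Lemma separated_inner_set O k :
  separated_sets (inner_set O k) (~` inner_set O k.+1).
Proof.
exists (k.+1%:R^-1 - k.+2%:R^-1)%R.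
  by rewrite subr_gt0 ltf_pV2 ?posrE ?ltr0n// ltr_nat.
move=> x z Okx /existsNP[y /not_implyP[Oy /negP]]; rewrite -ltNge => zy.
rewrite lerBlDr; apply: le_trans (Okx _ Oy) _.
by apply: le_trans (ler_enorm_dist z _ _) _; rewrite lerD2l ltW.
Qed.

Lemma separated_setsS A A' B B' : A' `<=` A -> B' `<=` B ->
  separated_sets A B -> separated_sets A' B'.
Proof. by move=> AA BB [d d0 h]; exists d => // x y /AA ? /BB; exact: h. Qed.

(** Caratheodory's criterion, for X of finite measure.  The part of X in an inner set is separated from
    the part of X outside O, so the inequality to prove holds with an inner set
    in place of O.  What is lost is the part of X in O outside the inner set.
    It is covered by the layers Y k between consecutive inner sets; those whose
    indices differ by at least 2 are separated, so their measures form a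
    convergent series and the loss is at most a tail of it. *)
Lemma metric_outer_measure_open (H : {outer_measure set E -> \bar R}) :
  (forall A B, separated_sets A B -> H A + H B <= H (A `|` B)) ->
  forall O, open O -> H.-caratheodory O.
Proof.
move=> Hsep O oO; apply: le_caratheodory_measurable => X.
have [->|HX] := eqVneq (H X) +oo; first exact: leey.
pose A := inner_set O.
pose Y k := X `&` (A k.+1 `\` A k).
have leHX Z : Z `<=` X -> H Z <= H X by exact: le_outer_measure.
(* The layer with index M.+1 is separated from the inner set with index M but
   not from the next one: hence the two terms on the right. *)
have Y_sum M : \sum_(k < M) H (Y k.+1) <= H (X `&` A M) + H (X `&` A M.+1).
  elim: M => [|M IH]; first by rewrite big_ord0 adde_ge0.
  rewrite big_ord_recr/=; apply: le_trans (leeD2r _ IH) _.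
  rewrite addeAC addeC leeD2l//.
  apply: le_trans (Hsep _ _ _) _; last first.
    apply: le_outer_measure => x [[Xx Ax]|[Xx [Ax _]]]; split => //.
    by move: Ax; apply: subset_inner_set; rewrite -addn2 leq_addr.
  apply: separated_setsS (separated_inner_set O M); first by move=> x [].
  by move=> x [_ []].
have Y_fin : \sum_(0 <= k <oo) H (Y k.+1) < +oo.
  apply: (@le_lt_trans _ _ (H X + H X)); last first.
    by rewrite lte_add_pinfty// ltey.
  apply: lime_le; first exact: is_cvg_nneseries.
  apply: nearW => M; rewrite big_mkord; apply: le_trans (Y_sum M) _.
  by apply: leeD; apply: leHX => x [].
apply/lee_addgt0Pr => e e0.
have tail0 := nneseries_tail_cvg Y_fin (fun k _ => outer_measure_ge0 H (Y k.+1)).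
have [|N _ /(_ N (leqnn N))/ltW Ne] := tail0 [set x | x < e%:E].
  apply: open_nbhs_nbhs; split; first exact: open_ereal_lt_ereal.
  by rewrite /= lte_fin.
have XO : X `&` O `<=` (X `&` A N.+1) `|` \bigcup_(k in ~` `I_N) Y k.+1.
  move=> x [Xx]; rewrite {1}(bigcup_inner_set oO) => -[k _ Akx].
  have [Ax|Ax] := pselect (A N.+1 x); first by left.
  pose P k := `[< A k x >].
  have exP : exists k, P k by exists k; apply/asboolP.
  have [m /asboolP Amx mmin] := ex_minnP exP.
  have Nm : (N.+1 < m)%N.
    rewrite ltnNge; apply/negP => mN; apply: Ax.
    exact: subset_inner_set Amx.
  case: m Amx mmin Nm => [//|[//|m]] Amx mmin Nm.
  right; exists m => /=; first by apply/negP; rewrite -leqNgt.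
  split => //; split => // Am1x; suff : (m.+2 <= m.+1)%N by rewrite ltnn.
  by apply: mmin; apply/asboolP.
apply: (@le_trans _ _ (H (X `&` A N.+1) + e%:E + H (X `&` ~` O))).
  apply: leeD2r; apply: le_trans (le_outer_measure _ _ _ XO) _.
  apply: le_trans (outer_measureU2 _ _ _) _; apply: leeD2l.
  by apply: le_trans Ne; exact: outer_measure_sigma_subadditive_tail.
rewrite addeAC leeD2r//; apply: le_trans (Hsep _ _ _) _.
  apply: separated_setsS (separated_inner_set O N.+1); first by move=> x [].
  by move=> x [_ Ox] /inner_set_sub.
by apply: leHX => x [|] [].
Qed.

End metric_outer_measure.

Section hausdorff_metric.
Context {R : realType} {n : nat}.
Local Notation E := 'rV[R]_n.
Local Open Scope ereal_scope.

Lemma enorm_le_ediam (U : set E) x y : U x -> U y ->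
  (enorm (x - y))%:E <= ediam U.
Proof. by move=> Ux Uy; apply: ereal_sup_ubound; exists x => //; exists y. Qed.

Lemma ediam_le (U : set E) (d : R) :
  (forall x y, U x -> U y -> (enorm (x - y) <= d)%R) -> ediam U <= d%:E.
Proof.
by move=> h; apply: ge_ereal_sup => _ [x Ux [y Uy <-]]; rewrite lee_fin h.
Qed.

Lemma ediam0 : ediam (set0 : set E) = -oo.
Proof.
rewrite /ediam (_ : [set _ | _ in _ & _ in _] = set0) ?ereal_sup0//.
by apply/seteqP; split => // y [].
Qed.

Lemma hausdorff_content_ge0 m d (A : set E) : 0 <= hausdorff_content m d A.
Proof.
apply: le_ereal_inf_tmp => _ [U _ <-].
by apply: nneseries_ge0 => k _ _; exact: hausdorff_weight_ge0.
Qed.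

Lemma le_hausdorff_content m (d d' : R) (A : set E) : (d <= d')%R ->
  hausdorff_content m d' A <= hausdorff_content m d A.
Proof.
move=> dd; apply: ereal_inf_le_tmp => _ [U [AU Ud] <-]; exists U => //.
by split => // k; apply: le_trans (Ud k) _; rewrite lee_fin.
Qed.

(** A set of diameter less than the distance of A and B meets at most one of
    them, so a fine cover of their union splits into a cover of each. *)
Lemma hausdorff_contentU_separated m (d : R) (A B : set E) :
  (forall x y, A x -> B y -> (d < enorm (x - y))%R) ->
  hausdorff_content m d A + hausdorff_content m d B <=
  hausdorff_content m d (A `|` B).
Proof.
move=> AB; apply: le_ereal_inf_tmp => _ [U [ABU Ud] <-].
pose V k := if `[< U k `&` A !=set0 >] then U k else set0.
pose W k := if `[< U k `&` A !=set0 >] then set0 else U k.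
have d_sub k (V' : set E) : V' = set0 \/ V' = U k -> ediam V' <= d%:E.
  by move=> [->|->]; rewrite ?ediam0 ?leNye.
apply: (@le_trans _ _ (\sum_(k <oo) hausdorff_weight m (V k) +
                       \sum_(k <oo) hausdorff_weight m (W k))).
  apply: leeD; apply: ereal_inf_lbound.
    exists V => //; split => [x Ax|k].
      have [k _ Ukx] := ABU _ (or_introl Ax); exists k => //.
      by rewrite /V asboolT//; exists x.
    by apply: (d_sub k); rewrite /V; case: ifP; [right|left].
  exists W => //; split => [y By|k].
    have [k _ Uky] := ABU _ (or_intror By); exists k => //.
    rewrite /W asboolF// => -[x [Ukx Ax]].
    have := le_trans (enorm_le_ediam Ukx Uky) (Ud k).
    by rewrite lee_fin leNgt AB.
  by apply: (d_sub k); rewrite /W; case: ifP; [left|right].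
rewrite -nneseriesD; try by move=> k _ _; exact: hausdorff_weight_ge0.
apply: lee_nneseries => [k _ _|k _].
  by apply: adde_ge0; exact: hausdorff_weight_ge0.
by rewrite /V /W; case: ifP; rewrite hausdorff_weight0 ?adde0 ?add0e.
Qed.

(** The content at a scale below the distance of A and B is additive on them;
    the two suprema over scales are taken one after the other. *)
Lemma hausdorffU_separated m (A B : set E) : separated_sets A B ->
  hausdorff m A + hausdorff m B <= hausdorff m (A `|` B).
Proof.
move=> [d d0 dAB].
have [->|HAB] := eqVneq (hausdorff m (A `|` B)) +oo; first exact: leey.
have cAB (a b : R) : (0 < a)%R -> (0 < b)%R ->
    hausdorff_content m a A + hausdorff_content m b B <= hausdorff m (A `|` B).
  move=> a0 b0; pose c := Num.min (d / 2)%R (Num.min a b).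
  have c0 : (0 < c)%R by rewrite !lt_min a0 b0 divr_gt0.
  apply: (@le_trans _ _ (hausdorff_content m c A + hausdorff_content m c B)).
    by apply: leeD; apply: le_hausdorff_content; rewrite !ge_min lexx ?orbT.
  apply: le_trans (hausdorff_contentU_separated _ _) _.
    move=> x y Ax By; apply: lt_le_trans (dAB _ _ Ax By).
    by rewrite gt_min ltr_pdivrMr// ltr_pMr// ltr1n.
  by apply: ereal_sup_ubound; exists c.
have HABfin : hausdorff m (A `|` B) \is a fin_num.
  by rewrite ge0_fin_numE ?ltey// outer_measure_ge0.
have cBfin b : (0 < b)%R -> hausdorff_content m b B \is a fin_num.
  move=> b0; rewrite ge0_fin_numE ?hausdorff_content_ge0//.
  apply: le_lt_trans (_ : hausdorff m (A `|` B) < +oo); last by rewrite ltey.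
  apply: le_trans (cAB 1%R b ltr01 b0).
  by rewrite leeDr// hausdorff_content_ge0.
have HAb b : (0 < b)%R ->
    hausdorff m A + hausdorff_content m b B <= hausdorff m (A `|` B).
  move=> b0; rewrite -leeBrDr ?cBfin//; apply: ge_ereal_sup => _ [a a0 <-].
  by rewrite leeBrDr ?cBfin// cAB.
have HAfin : hausdorff m A \is a fin_num.
  rewrite ge0_fin_numE ?outer_measure_ge0//.
  apply: le_lt_trans (_ : hausdorff m (A `|` B) < +oo); last by rewrite ltey.
  by apply: le_trans (HAb 1%R ltr01); rewrite leeDl// hausdorff_content_ge0.
rewrite -leeBrDl//; apply: ge_ereal_sup => _ [b b0 <-].
by rewrite leeBrDl// HAb.
Qed.

Lemma measurable_open_hausdorff m (O : set E) : open O ->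
  (@hausdorff R n m).-cara.-measurable O.
Proof.
exact: (@metric_outer_measure_open _ _ (@hausdorff R n m)
  (@hausdorffU_separated m)).
Qed.

End hausdorff_metric.

(** * Upper Ahlfors regularity of Lipschitz boundaries *)

Section hausdorff_upper_bounds.
Context {R : realType} {n : nat}.
Local Notation E := 'rV[R]_n.
Local Open Scope ereal_scope.

Lemma hausdorff_weight_le m (U : set E) (d : R) : (0 <= d)%R ->
  ediam U <= d%:E ->
  hausdorff_weight m U <= (unit_ball_volume m * (d / 2) ^+ m)%:E.
Proof.
move=> d0 Ud; rewrite /hausdorff_weight; case: asboolP => [U0|/eqP/set0P[x Ux]].
  by rewrite lee_fin mulr_ge0 ?unit_ball_volume_ge0 ?exprn_ge0 ?divr_ge0.
have dU0 : 0 <= ediam U.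
  by apply: le_trans (enorm_le_ediam Ux Ux); rewrite lee_fin enorm_ge0.
have dU : ediam U \is a fin_num.
  by rewrite ge0_fin_numE//; apply: le_lt_trans Ud _; exact: ltry.
rewrite -(fineK dU) -EFinM -EFin_expe -EFinM lee_fin.
rewrite ler_wpM2l ?unit_ball_volume_ge0// lerXn2r ?nnegrE.
- by [].
- by rewrite mulr_ge0 ?invr_ge0 ?fine_ge0.
- by rewrite divr_ge0.
by rewrite ler_wpM2r ?invr_ge0// -lee_fin fineK.
Qed.

Lemma hausdorff_content_fin_cover (I : finType) m (d : R) (A : set E)
    (V : I -> set E) : (0 <= d)%R ->
  A `<=` \bigcup_i V i -> (forall i, ediam (V i) <= d%:E) ->
  hausdorff_content m d A <=
  (#|I|%:R * (unit_ball_volume m * (d / 2) ^+ m))%:E.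
Proof.
move=> d0 AV Vd.
pose U k := if insub k is Some i then V (@enum_val I predT i) else set0.
have Ud k : ediam (U k) <= d%:E.
  by rewrite /U; case: insub => [i|]; rewrite ?ediam0 ?leNye.
apply: (@le_trans _ _ (\sum_(k <oo) hausdorff_weight m (U k))).
  apply: ereal_inf_lbound; exists U => //; split => // x /AV[i _ Vix].
  exists (enum_rank i) => //.
  by rewrite /U (valK (enum_rank i)) enum_rankK.
rewrite (nneseries_split 0 #|I|); last first.
  by move=> k _; exact: hausdorff_weight_ge0.
rewrite add0n [X in _ + X]eseries0 ?adde0; last first.
  move=> k Ik _; rewrite /U insubN ?hausdorff_weight0//.
  by rewrite -leqNgt.
rewrite big_mkord.
apply: (@le_trans _ _ (\sum_(k < #|I|) (unit_ball_volume m * (d / 2) ^+ m)%:E)).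
  by apply: lee_sum => k _; exact: hausdorff_weight_le.
by rewrite sumEFin sumr_const card_ord mulr_natl.
Qed.

(** The image of a cube of side 2 s is cut into N ^ m pieces of diameter of
    order s / N, whose total weight does not depend on N. *)
Lemma hausdorff_lipschitz_image m (F : 'rV[R]_m -> E) (S : set 'rV[R]_m)
    (M s : R) (c : 'rV[R]_m) : (0 <= M)%R -> (0 < s)%R ->
  (forall a b, S a -> S b -> (enorm (F a - F b) <= M * enorm (a - b))%R) ->
  (forall a i, S a -> (`|a 0%R i - c 0%R i| < s)%R) ->
  hausdorff m (F @` S) <=
    (unit_ball_volume m * (M * Num.sqrt m%:R * s) ^+ m)%:E.
Proof.
move=> M0 s0 FM Sc; apply: ge_ereal_sup => _ [d d0 <-].
pose D := (M * Num.sqrt m%:R * (2 * s))%R.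
have D0 : (0 <= D)%R by rewrite !mulr_ge0 ?sqrtr_ge0// ltW.
pose N := (Num.truncn (D / d)).+1.
have N0 : (0 < N%:R :> R)%R by rewrite ltr0n.
have DNd : (D / N%:R <= d)%R.
  by rewrite ler_pdivrMr// mulrC -ler_pdivrMr// ltW// truncnS_gt.
pose X (a : 'rV[R]_m) (i : 'I_m) := ((a 0 i - c 0 i + s) * (N%:R / (2 * s)))%R.
pose cell a i : nat := Num.truncn (X a i).
have Ns0 : (0 < N%:R / (2 * s))%R by rewrite divr_gt0 ?mulr_gt0.
have X_ge0 a i : S a -> (0 <= X a i)%R.
  move=> /Sc-/(_ i); rewrite ltr_norml => /andP[h _].
  by rewrite mulr_ge0 ?(ltW Ns0)// ltW// -ltrBlDr sub0r.
have cellN a i : S a -> (cell a i < N)%N.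
  move=> Sa; rewrite /cell truncn_lt_nat ?X_ge0// /X mulrA ltr_pdivrMr ?mulr_gt0//.
  rewrite mulrC ltr_pM2l//; have := Sc _ i Sa; rewrite ltr_norml => /andP[_].
  by lra.
pose V (f : {ffun 'I_m -> 'I_N}) := F @` [set a | S a /\ forall i, cell a i = f i].
have Vd f : ediam (V f) <= (D / N%:R)%:E.
  apply: ediam_le => _ _ [a [Sa fa] <-] [b [Sb fb] <-].
  apply: le_trans (FM _ _ Sa Sb) _.
  rewrite /D -[X in (_ <= X)%R]mulrA -[X in (_ <= X)%R]mulrA ler_wpM2l//.
  apply: le_trans (enorm_le_norm _) _.
  rewrite ler_wpM2l ?sqrtr_ge0// [leLHS]/Num.norm/= mx_normrE.
  apply/bigmax_leP; split; first by rewrite divr_ge0 ?mulr_ge0 ?ltW.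
  move=> [i j] _ /=; rewrite ord1 !mxE.
  have /andP[a1 a2] := truncn_itv (X_ge0 _ j Sa).
  have /andP[b1 b2] := truncn_itv (X_ge0 _ j Sb).
  rewrite -/(cell a j) fa in a1 a2; rewrite -/(cell b j) fb in b1 b2.
  rewrite -invf_div -[X in (_ <= X)%R]mul1r ler_pdivlMr//.
  rewrite -[X in (_ * X)%R](gtr0_norm Ns0) -normrM.
  rewrite (_ : ((a 0 j - b 0 j) * _)%R = (X a j - X b j)%R); last first.
    by rewrite /X; ring.
  rewrite -natr1 in a2 b2; rewrite ler_norml; apply/andP; split; lra.
have FV : F @` S `<=` \bigcup_f V f.
  move=> _ [a Sa <-]; exists [ffun i => Ordinal (cellN a i Sa)] => //.
  by exists a => //; split=> // i; rewrite ffunE.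
apply: le_trans (le_hausdorff_content _ _ DNd) _.
apply: le_trans (hausdorff_content_fin_cover _ _ FV Vd) _.
  by rewrite divr_ge0// ltW.
rewrite lee_fin card_ffun !card_ord natrX mulrCA -exprMn.
rewrite ler_wpM2l ?unit_ball_volume_ge0// (_ : (N%:R * _)%R = (M * Num.sqrt m%:R * s)%R)//.
by rewrite /D; field; rewrite gt_eqF.
Qed.

End hausdorff_upper_bounds.

Section lipschitz_boundary.
Context {R : realType} {n : nat}.
Local Notation E := 'rV[R]_n.
Implicit Types Omega : set E.

Lemma enorm_dot m (v : 'rV[R]_m) : enorm v ^+ 2 = (v *m v^T) 0 0.
Proof. by rewrite enorm_sqr mxE; apply: eq_bigr => i _; rewrite mxE expr2. Qed.

Lemma enorm_mul_isometry m k (Q : 'M[R]_(m, k)) (v : 'rV[R]_m) :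
  Q *m Q^T = 1%:M -> enorm (v *m Q) = enorm v.
Proof.
move=> QQ; apply/eqP; rewrite -(@eqrXn2 _ 2) ?enorm_ge0//; apply/eqP.
by rewrite !enorm_dot trmx_mul mulmxA -(mulmxA v) QQ mulmx1.
Qed.

Lemma mulmx1C_eqdim m k (Q : 'M[R]_(m, k)) (P : 'M[R]_(k, m)) :
  m = k -> Q *m P = 1%:M -> P *m Q = 1%:M.
Proof. by move=> mk; subst k; exact: mulmx1C. Qed.

Lemma enorm_row_mx_sqr m k (a : 'rV[R]_m) (b : 'rV[R]_k) :
  enorm (row_mx a b) ^+ 2 = enorm a ^+ 2 + enorm b ^+ 2.
Proof. by rewrite !enorm_dot tr_row_mx mul_row_col mxE. Qed.

Lemma enorm_lsubmx m k (v : 'rV[R]_(m + k)) : enorm (lsubmx v) <= enorm v.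
Proof.
rewrite -(@ler_pXn2r _ 2)// ?nnegrE ?enorm_ge0//.
by rewrite -[in leRHS](hsubmxK v) enorm_row_mx_sqr lerDl sqr_ge0.
Qed.

Lemma enorm_rsubmx m (v : 'rV[R]_(m + 1)) : `|rsubmx v 0 0| <= enorm v.
Proof. by rewrite mxE coord_le_enorm. Qed.

Lemma enorm_scalar_mx1 (t : R) : enorm (t%:M : 'rV[R]_1) = `|t|.
Proof.
rewrite /enorm big_ord_recl big_ord0 addr0 mxE eqxx mulr1n.
exact: sqrtr_sqr.
Qed.

Lemma enorm_row_mx_le m k (a : 'rV[R]_m) (b : 'rV[R]_k) :
  enorm (row_mx a b) <= enorm a + enorm b.
Proof.
rewrite -(@ler_pXn2r _ 2)// ?nnegrE ?addr_ge0 ?enorm_ge0//.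
by rewrite enorm_row_mx_sqr sqrrD addrAC lerDl mulrn_wge0// mulr_ge0 ?enorm_ge0.
Qed.

(** Points above the graph have a neighbourhood above the graph, so they are
    not in the closure of the domain, while points below it are interior: near
    p the boundary is contained in the graph, which is a Lipschitz image of a
    piece of a hyperplane. *)
Lemma lipschitz_domain_local_graph Omega p : (0 < n)%N -> open Omega ->
  lipschitz_domain Omega -> boundary Omega p ->
  exists (rho M : R) (F : 'rV[R]_n.-1 -> E) (D : set 'rV[R]_n.-1),
   [/\ 0 < rho, 0 <= M,
     boundary Omega `&` eball p rho `<=` F @` D,
     forall a b, D a -> D b -> enorm (F a - F b) <= M * enorm (a - b) &
     forall a b, enorm (a - b) <= enorm (F a - F b)].
Proof.
move=> n0 oO lO bp.
have [Q [r [delta [L [phi [[QQ r0 d0] [phi0 phid phiL graph]]]]]]] := lO _ bp.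
have dimE : (n.-1 + 1 = n)%N by rewrite addn1 prednK.
have QTQ := mulmx1C_eqdim dimE QQ.
pose F eta := p + row_mx eta (phi eta)%:M *m Q.
have phiL' eta eta' : eball 0 r eta -> eball 0 r eta' ->
    `|phi eta - phi eta'| <= `|L| * enorm (eta - eta').
  move=> e1 e2; apply: le_trans (phiL _ _ e1 e2) _.
  by rewrite ler_wpM2r ?enorm_ge0 ?ler_norm.
have FB a b : enorm (F a - F b) =
    enorm (row_mx (a - b) (phi a - phi b)%:M).
  rewrite /F opprD addrACA subrr add0r -mulmxBl enorm_mul_isometry//.
  by rewrite opp_row_mx add_row_mx raddfB.
exists (Num.min r delta), (1 + `|L|), F, (eball 0 r); split.
- by rewrite lt_min r0 d0.
- by rewrite addr_ge0.
- move=> y [[cy iy]]; rewrite /eball/= lt_min => /andP[yr yd].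
  pose coords (z : E) := (z - p) *m Q^T.
  have coordsK z : z = p + row_mx (lsubmx (coords z)) (rsubmx (coords z) 0 0)%:M *m Q.
    rewrite -mx11_scalar hsubmxK /coords -mulmxA QTQ mulmx1.
    by rewrite addrC subrK.
  have norm_coords z : enorm (coords z) = enorm (z - p).
    by rewrite /coords enorm_mul_isometry// trmxK.
  have coordsB z : coords z - coords y = (z - y) *m Q^T.
    by rewrite /coords -mulmxBl opprB addrA subrK.
  pose eta z := lsubmx (coords z); pose t z := rsubmx (coords z) 0 0.
  have eta_r z : enorm (z - p) < r -> eball 0 r (eta z).
    move=> zr; rewrite /eball/= subr0; apply: le_lt_trans zr.
    by rewrite -norm_coords enorm_lsubmx.
  have t_d z : enorm (z - p) < delta -> `|t z| < delta.
    by move=> zd; apply: le_lt_trans zd; rewrite -norm_coords enorm_rsubmx.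
  have graphE z : enorm (z - p) < r -> enorm (z - p) < delta ->
      Omega z <-> t z < phi (eta z).
    move=> zr zd; rewrite [X in Omega X]coordsK; apply: graph.
      exact: eta_r.
    exact: t_d.
  have ty : t y = phi (eta y).
    apply/eqP; rewrite eq_le; apply/andP; split; rewrite leNgt; apply/negP => lt_t.
      (* If y were above the graph, so would be all points closer to y than e,
         as the height above the graph is Lipschitz with constant 1 + |L|. *)
      pose e := Num.min (Num.min (r - enorm (y - p)) (delta - enorm (y - p)))
        ((t y - phi (eta y)) / (2 + `|L|)).
      have L0 : 0 < 2 + `|L| by rewrite ltr_wpDr.
      have e0 : 0 < e by rewrite !lt_min !subr_gt0 yr yd divr_gt0// subr_gt0.
      have [z [Oz]] := cy _ (nbhs_eball y e0).
      rewrite !lt_min => /andP[/andP[zr zd] zt].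
      have yz := ler_enorm_dist y z p.
      have {}zr : enorm (z - p) < r by lra.
      have {}zd : enorm (z - p) < delta by lra.
      have := (graphE z zr zd).1 Oz; apply/negP; rewrite -leNgt.
      move: zt; rewrite ltr_pdivlMr// => zt.
      have etaB : enorm (eta z - eta y) <= enorm (z - y).
        rewrite -(@enorm_mul_isometry _ _ Q^T (z - y)) ?trmxK//.
        rewrite -coordsB /eta -raddfB; exact: enorm_lsubmx.
      have tB : `|t z - t y| <= enorm (z - y).
        rewrite -(@enorm_mul_isometry _ _ Q^T (z - y)) ?trmxK//.
        rewrite -coordsB (_ : t z - t y = rsubmx (coords z - coords y) 0 0).
          exact: enorm_rsubmx.
        by rewrite raddfB/= [RHS]mxE [X in _ = _ + X]mxE.
      have := phiL' _ _ (eta_r _ zr) (eta_r _ yr).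
      rewrite ler_norml => /andP[_ phiB].
      have : `|L| * enorm (eta z - eta y) <= `|L| * enorm (z - y).
        by rewrite ler_wpM2l.
      move: tB; rewrite ler_norml => /andP[tB _].
      have := enorm_ge0 (z - y); rewrite mulrDr in zt; lra.
    apply: iy; suff Oy : Omega y by move: oO; rewrite openE; exact.
    exact/graphE.
  exists (eta y); first exact: eta_r.
  by rewrite /F -ty -coordsK.
- move=> a b Da Db; rewrite FB; apply: le_trans (enorm_row_mx_le _ _) _.
  by rewrite enorm_scalar_mx1 mulrDl mul1r lerD2l phiL'.
- move=> a b; rewrite FB; set v := row_mx _ _.
  by have := enorm_lsubmx v; rewrite row_mxKl.
Qed.

(** Upper Ahlfors regularity with exponent m. *)
Definition upper_regular (m : nat) (G : set E) (C : R) : Prop :=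
  forall x s, 0 < s -> (hausdorff m (G `&` eball x s) <= (C * s ^+ m)%:E)%E.

Lemma upper_regularU m (G1 G2 : set E) (C1 C2 : R) :
  upper_regular m G1 C1 -> upper_regular m G2 C2 ->
  upper_regular m (G1 `|` G2) (C1 + C2).
Proof.
move=> h1 h2 x s s0; rewrite setIUl mulrDl EFinD.
by apply: le_trans (outer_measureU2 _ _ _) _; apply: leeD; [exact: h1|exact: h2].
Qed.

Lemma upper_regularS m (G1 G2 : set E) (C : R) : G1 `<=` G2 ->
  upper_regular m G2 C -> upper_regular m G1 C.
Proof.
move=> G12 h x s s0; apply: le_trans (h x s s0).
by apply: le_outer_measure; exact: setSI.
Qed.

(** As F does not decrease distances, the part of the image in a ball of radius
    s comes from a set of diameter less than 2 s, hence from a cube of side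
    4 s. *)
Lemma lipschitz_image_upper_regular m (F : 'rV[R]_m -> E) (D : set 'rV[R]_m)
    (M : R) : 0 <= M ->
  (forall a b, D a -> D b -> enorm (F a - F b) <= M * enorm (a - b)) ->
  (forall a b, enorm (a - b) <= enorm (F a - F b)) ->
  upper_regular m (F @` D)
    (unit_ball_volume m * (M * Num.sqrt m%:R * 2) ^+ m).
Proof.
move=> M0 FM Fexp x s s0; pose S := D `&` F @^-1` eball x s.
have -> : F @` D `&` eball x s = F @` S.
  apply/seteqP; split => [y [[a Da <-{y}] Fa]|y [a [Da Fa] <-{y}]].
    by exists a.
  by split => //; exists a.
have [[c [Dc Fc]]|S0] := pselect (S !=set0); last first.
  have -> : F @` S = set0 by apply/seteqP; split => // y [a Sa _]; apply: S0; exists a.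
  by rewrite outer_measure0 lee_fin !mulr_ge0 ?unit_ball_volume_ge0
    ?exprn_ge0 ?mulr_ge0 ?sqrtr_ge0 ?(ltW s0).
rewrite -mulrA -exprMn -[X in (X ^+ m)%R]mulrA.
apply: (@hausdorff_lipschitz_image _ _ _ F S M (2 * s) c) => //.
- by rewrite mulr_gt0.
- by move=> a b [Da _] [Db _]; exact: FM.
move=> a i [Da Fa]; apply: le_lt_trans (_ : enorm (a - c) < _).
  by have := coord_le_enorm (a - c) i; rewrite !mxE.
apply: le_lt_trans (Fexp _ _) _; apply: le_lt_trans (ler_enorm_dist x _ _) _.
by rewrite (enormB x) mulr_natl mulr2n ltrD.
Qed.

Lemma closed_boundary Omega : closed (boundary Omega).
Proof.
rewrite /boundary setDE; apply: closedI; first exact: closed_closure.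
by apply: open_closedC; exact: open_interior.
Qed.

Lemma bounded_boundary Omega : bounded_set Omega -> bounded_set (boundary Omega).
Proof.
move=> [M [Mreal OM]]; exists M; split => // N MN x [cx _].
have cN : closed [set y : E | `|y| <= N].
  rewrite (_ : [set _ | _] = (fun y : E => `|y|) @^-1` [set t | t <= N])//.
  apply: closed_comp; last exact: closed_le.
  by move=> y _; exact: norm_continuous.
by move: cx; rewrite closureE => /(_ _ (conj cN (OM _ MN))).
Qed.

Lemma compact_boundary Omega : bounded_set Omega -> compact (boundary Omega).
Proof.
move=> bO; apply: bounded_closed_compact; first exact: bounded_boundary.
exact: closed_boundary.
Qed.

(** Finitely many of the balls in which the boundary is contained in a graph
    cover it, and the constants of regularity add up under unions. *)
Lemma lipschitz_boundary_upper_regular Omega : (0 < n)%N ->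
  bounded_set Omega -> open Omega -> lipschitz_domain Omega ->
  exists C, upper_regular n.-1 (boundary Omega) C.
Proof.
move=> n0 bO oO lO.
have loc p : exists rC : R * R, boundary Omega p ->
    0 < rC.1 /\ upper_regular n.-1 (boundary Omega `&` eball p rC.1) rC.2.
  have [bp|nbp] := pselect (boundary Omega p); last by exists (0, 0).
  have [r [M [F [D [r0 M0 sub FM Fexp]]]]] :=
    lipschitz_domain_local_graph n0 oO lO bp.
  eexists (r, _) => _; split => //=; apply: upper_regularS sub _.
  exact: (lipschitz_image_upper_regular M0 FM Fexp).
have [rC rCP] := choice loc.
have := compact_boundary bO; rewrite compact_cover.
move=> /(_ E (boundary Omega) (fun p => eball p (rC p).1)).
case=> [p _|p bp|D DO OD]; first exact: open_eball.
  by exists p => //; rewrite /eball/= subrr enorm0; case: (rCP _ bp).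
have : exists C, upper_regular n.-1
    (\bigcup_(p in [set p | p \in (D : seq E)]) (boundary Omega `&` eball p (rC p).1)) C.
  have : {in (D : seq E), forall p, boundary Omega p}.
    by move=> p /DO/set_mem.
  elim: (D : seq E) => [|p s IH] bs.
    exists 0 => x s s0; rewrite mul0r (_ : _ `&` _ = set0) ?outer_measure0//.
    by apply/seteqP; split => // y [[p]].
  have [|C hC] := IH; first by move=> q qs; apply: bs; rewrite inE qs orbT.
  have [_ hp] := rCP p (bs _ (mem_head _ _)).
  exists ((rC p).2 + C); apply: upper_regularS (upper_regularU hp hC).
  move=> y [q /=]; rewrite inE => /orP[/eqP ->|qs] yq; first by left.
  by right; exists q.
move=> [C hC]; exists C; apply: upper_regularS hC => y yO.
by have [p pD yp] := OD y yO; exists p.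
Qed.

End lipschitz_boundary.

(** * Integrals of powers of the distance *)

Section integral_cover.
Context d (T : measurableType d) (R : realType).
Variable mu : {measure set T -> \bar R}.
Local Open Scope ereal_scope.

(** The function f is dominated by the sum of the functions c k * \1_(A k). *)
Lemma integral_le_cover (D : set T) (f : T -> R) (A : nat -> set T)
    (c w : nat -> R) : measurable D -> measurable_fun D f ->
  (forall y, D y -> (0 <= f y)%R) ->
  (forall k, measurable (A k)) -> (forall k, (0 <= c k)%R) ->
  (forall k, mu (D `&` A k) <= (w k)%:E) ->
  (forall y, D y -> (0 < f y)%R -> exists2 k, A k y & (f y <= c k)%R) ->
  \int[mu]_(y in D) (f y)%:E <= \sum_(k <oo) (c k * w k)%:E.
Proof.
move=> mD mf f0 mA c0 Aw fc.
pose g k y : \bar R := (c k * \1_(A k) y)%R%:E.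
have g0 k y : 0 <= g k y by rewrite lee_fin mulr_ge0.
have mg k : measurable_fun D (g k).
  apply/measurable_EFinP; apply: measurable_funM; first exact: measurable_cst.
  exact: measurable_indic.
apply: (@le_trans _ _ (\int[mu]_(y in D) \sum_(k <oo) g k y)).
  apply: ge0_le_integral => //.
  - exact/measurable_EFinP.
  - by apply: ge0_emeasurable_sum.
  move=> y Dy; have := f0 y Dy; rewrite le_eqVlt => /orP[/eqP <-|fy].
    by apply: nneseries_ge0.
  have [k Aky fck] := fc y Dy fy.
  apply: (@le_trans _ _ (g k y)).
    by rewrite /g lee_fin indicE mem_set// mulr1.
  rewrite (@nneseriesD1 _ _ k)//; by rewrite leeDl// nneseries_ge0.
rewrite integral_nneseries//; apply: lee_nneseries => [k _ _|k _].
  exact: integral_ge0.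
rewrite /g; under eq_integral do rewrite EFinM.
rewrite ge0_integralZl//.
- rewrite integral_indic// EFinM setIC.
  by apply: lee_wpmul2l; rewrite ?lee_fin.
- by apply/measurable_EFinP; exact: measurable_indic.
- by rewrite lee_fin.
Qed.

End integral_cover.

Section powers.
Context {R : realType}.

(** On a dyadic shell a power, positive or negative, of the distance is
    comparable to the same power of the scale. *)
Lemma powR_doubling (g r t : R) : 0 < r -> r / 2 <= t -> t <= 2 * r ->
  t `^ (- g) <= 2 `^ `|g| * r `^ (- g).
Proof.
move=> r0 rt tr; have t0 : 0 < t by apply: lt_le_trans rt; rewrite divr_gt0.
rewrite /powR !gt_eqF// -expRD ler_expR.
have h1 : ln t - ln r <= ln 2.
  by rewrite lerBlDr -lnM ?posrE// ler_ln ?posrE ?mulr_gt0.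
have h2 : ln r - ln t <= ln 2.
  rewrite lerBlDr -lnM ?posrE// ler_ln ?posrE ?mulr_gt0//.
  by rewrite mulrC -ler_pdivrMr.
have : `|g * (ln r - ln t)| <= `|g| * ln 2.
  by rewrite normrM ler_wpM2l// ler_norml h2 andbT lerNl opprB.
by rewrite ler_norml => /andP[_]; lra.
Qed.

Lemma dyadic_scale_lt (s t : R) : 0 < t -> t < s ->
  exists k, s * 2^-1 ^+ k / 2 <= t < 2 * (s * 2^-1 ^+ k).
Proof.
move=> t0 ts; have s0 := lt_trans t0 ts.
have exk : exists k, s * 2^-1 ^+ k / 2 <= t.
  exists (Num.truncn (s / t)); set k := Num.truncn _.
  have kexp : k.+1%:R <= 2 ^+ k :> R by rewrite -natrX ler_nat ltn_expl.
  rewrite exprVn -mulrA -invfM ler_pdivrMr ?mulr_gt0 ?exprn_gt0//.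
  have : s / t < k.+1%:R by exact: truncnS_gt.
  rewrite ltr_pdivrMr// => /ltW/le_trans; apply.
  rewrite mulrC ler_wpM2l ?(ltW t0)//; apply: le_trans kexp _.
  by rewrite ler_peMr ?exprn_ge0// ler1n.
have [k kt kmin] := ex_minnP exk; exists k; rewrite kt/=.
case: k kt kmin => [|k] kt kmin; first by rewrite expr0 mulr1; lra.
have : t < s * 2^-1 ^+ k / 2.
  by rewrite ltNge; apply/negP => /kmin; rewrite ltnn.
by rewrite exprS; lra.
Qed.

Lemma dyadic_scale_ge (s t : R) : 0 < s -> s <= t ->
  exists k, [/\ s * 2 ^+ k / 2 <= t, t < 2 * (s * 2 ^+ k) & s * 2 ^+ k <= t].
Proof.
move=> s0 st.
have exk : exists k, t < 2 * (s * 2 ^+ k).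
  exists (Num.truncn (t / s)); set k := Num.truncn _.
  have kexp : k.+1%:R <= 2 ^+ k :> R by rewrite -natrX ler_nat ltn_expl.
  have : t / s < k.+1%:R by exact: truncnS_gt.
  rewrite ltr_pdivrMr// => /lt_le_trans; apply.
  rewrite mulrCA mulrC ler_wpM2l ?(ltW s0)//; apply: le_trans kexp _.
  by rewrite ler_peMl ?exprn_ge0// ler1n.
have [k kt kmin] := ex_minnP exk.
have skt : s * 2 ^+ k <= t.
  case: k kt kmin => [|k] kt kmin; first by rewrite expr0 mulr1.
  have : 2 * (s * 2 ^+ k) <= t.
    by rewrite leNgt; apply/negP => /kmin; rewrite ltnn.
  by rewrite exprS; lra.
exists k; split => //; apply: le_trans skt.
by rewrite ler_pdivrMr// ler_peMr ?ler1n// mulr_ge0 ?exprn_ge0// ltW.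
Qed.

Lemma nneseries_geometric_le (a q : R) : 0 <= a -> 0 < q -> q < 1 ->
  (\sum_(k <oo) (a * q ^+ k)%:E <= (a / (1 - q))%:E)%E.
Proof.
move=> a0 q0 q1; apply: lime_le.
  apply: is_cvg_nneseries => k _ _.
  by rewrite lee_fin mulr_ge0// exprn_ge0// ltW.
apply: nearW => N; rewrite sumEFin lee_fin.
by apply: geometric_le_lim; rewrite // gtr0_norm.
Qed.

End powers.

Section surface_integrals.
Context {R : realType} {n : nat}.
Local Notation E := 'rV[R]_n.
Local Notation m := n.-1.
Local Notation T := (caratheodory_type (@hausdorff R n n.-1)).

Lemma measurable_open_area (O : set E) : open O -> measurable (O : set T).
Proof. exact: measurable_open_hausdorff. Qed.

Lemma measurable_closed_area (F : set E) : closed F -> measurable (F : set T).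
Proof.
move=> cF; rewrite -[F]setCK; apply: measurableC.
by apply: measurable_open_area; exact: closed_openC.
Qed.

Lemma measurable_set1_area (x : E) : measurable ([set x] : set T).
Proof.
apply: measurable_closed_area.
exact: (compact_closed (@norm_hausdorff _ _) (@compact_set1 _ x)).
Qed.

Lemma measurable_within_continuous (D : set E) (f : E -> R) :
  measurable (D : set T) -> {within D, continuous f} ->
  measurable_fun (D : set T) f.
Proof.
move=> mD /continuousP cf; apply: (measurability _ (RGenOpens.measurableE R)).
move=> _ [_ [a [b ->] <-]].
have /open_subspaceP[V oV VD] :
    open (f @^-1` `]a, b[%classic : set (subspace D)).
  exact/cf/interval_open.
rewrite setIC -VD; apply: measurableI => //; exact: measurable_open_area.
Qed.

Lemma measurable_enorm_sub (D : set E) (x : E) :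
  measurable_fun (D : set T) (fun y => enorm (x - y)).
Proof.
apply: measurable_funTS; apply: measurable_within_continuous.
  exact: measurableT.
by apply: continuous_subspaceT; exact: enorm_sub_continuous.
Qed.

(** The kernel of a Riesz potential.  No dyadic shell around x contains x, so
    the kernel can be dominated shell by shell only with the value 0 at its
    pole. *)
Definition riesz (g : R) (x y : E) : R :=
  if x == y then 0 else enorm (x - y) `^ (- g).

Lemma riesz_ge0 g x y : 0 <= riesz g x y.
Proof. by rewrite /riesz; case: ifP => // _; exact: powR_ge0. Qed.

Lemma measurable_riesz (D : set E) g x : measurable_fun (D : set T) (riesz g x).
Proof.
apply: measurable_funTS.
rewrite (_ : riesz g x =
    (fun y : T => \1_(~` [set x] : set T) y * enorm (x - y) `^ (- g))).
  apply: measurable_funM.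
    by apply: measurable_indic; apply: measurableC; exact: measurable_set1_area.
  exact: (measurableT_comp (measurable_powR (- g)) (measurable_enorm_sub x)).
apply/funext => y; rewrite /riesz indicE.
case: eqVneq => [<-|xy].
  by rewrite memNset ?mul0r// => /(_ erefl).
by rewrite mem_set ?mul1r// => yx; rewrite yx eqxx in xy.
Qed.

Lemma measurable_trunc_riesz (D S : set E) g x : measurable (S : set T) ->
  measurable_fun (D : set T) (fun y => \1_S y * riesz g x y).
Proof.
move=> mS; apply: measurable_funM; last exact: measurable_riesz.
exact: measurable_indic.
Qed.

Context (G : set E) (C : R).
Context (closedG : closed G) (regG : upper_regular m G C).

Lemma upper_regular_ge0 : 0 <= C.
Proof.
have := regG 0 (ltr01 : 0 < 1); rewrite expr1n mulr1 -lee_fin.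
by apply: le_trans; exact: outer_measure_ge0.
Qed.

(* The constant attached to one dyadic shell: 2 ^ |g| compares the kernel with
   its value at the scale r k, and C * 2 ^ m * r k ^ m bounds the area of the
   ball of radius 2 * r k. *)
Let A (g : R) := 2 `^ `|g| * C * 2 ^+ m.

(** On the shell of scale r k the kernel is of order r k ^ (- g), and the shell
    has area at most of order r k ^ m. *)
Lemma integral_riesz_dyadic g x (S : set E) (P : pred nat) (r : nat -> R) :
  measurable (S : set T) -> (forall k, 0 < r k) ->
  (forall y, G y -> S y -> x != y ->
    exists k, [/\ P k, r k / 2 <= enorm (x - y) & enorm (x - y) < 2 * r k]) ->
  (\int[area]_(y in G) (\1_S y * riesz g x y)%:E <=
   \sum_(k <oo) ((P k)%:R * (A g * r k `^ (m%:R - g)))%:E)%E.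
Proof.
move=> mS r0 cover.
have mG : measurable (G : set T) by exact: measurable_closed_area.
pose c k := (P k)%:R * (2 `^ `|g| * r k `^ (- g)).
pose w k := C * (2 * r k) ^+ m.
apply: le_trans (@integral_le_cover _ _ _ area G _
  (fun k => eball x (2 * r k)) c w mG _ _ _ _ _ _) _.
- exact: measurable_trunc_riesz.
- by move=> y _; rewrite mulr_ge0 ?riesz_ge0.
- by move=> k; apply: measurable_open_area; exact: open_eball.
- by move=> k; rewrite !mulr_ge0 ?powR_ge0.
- by move=> k; apply: regG; rewrite mulr_gt0.
- move=> y Gy; rewrite indicE; case: (boolP (y \in S)); last first.
    by rewrite mul0r ltxx.
  rewrite mul1r => /set_mem Sy; rewrite /riesz; case: eqVneq => [|xy].
    by rewrite ltxx.
  move=> _; have [k [Pk rk kr]] := cover y Gy Sy xy.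
  exists k; first by rewrite /eball/= enormB.
  by rewrite /c Pk mul1r powR_doubling// ltW.
apply: lee_nneseries => [k _ _|k _].
  rewrite lee_fin !mulr_ge0 ?powR_ge0 ?exprn_ge0 ?mulr_ge0 ?(ltW (r0 k))//.
  exact: upper_regular_ge0.
rewrite lee_fin /c /w /A.
have -> : r k `^ (m%:R - g) = r k `^ (- g) * r k ^+ m.
  have rk0 : r k != 0 by rewrite gt_eqF.
  by rewrite powRD ?rk0 ?implybT// powR_mulrn ?(ltW (r0 k))// mulrC.
rewrite exprMn.
by rewrite le_eqVlt; apply/orP; left; apply/eqP; ring.
Qed.

Lemma powR_exprn (q a : R) k : 0 <= q -> (q ^+ k) `^ a = (q `^ a) ^+ k.
Proof.
move=> q0; rewrite -(powR_mulrn k q0) -(powR_mulrn k (powR_ge0 q a)).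
by rewrite -!powRrM mulrC.
Qed.

(** The scales s / 2 ^ k give a geometric series of ratio 2 ^ (g - m) < 1. *)
Lemma integral_riesz_near g : g < m%:R -> exists2 B, 0 <= B &
  forall x s, 0 < s ->
  (\int[area]_(y in G) (\1_(eball x s) y * riesz g x y)%:E <=
   (B * s `^ (m%:R - g))%:E)%E.
Proof.
move=> gm; pose a : R := m%:R - g; have a0 : 0 < a by rewrite subr_gt0.
pose q : R := 2^-1 `^ a.
have q0 : 0 < q by rewrite powR_gt0// invr_gt0.
have q1 : q < 1.
  have -> : 1 = 1 `^ a by rewrite powR1.
  by rewrite gt0_ltr_powR ?nnegrE// invf_lt1// ltr1n.
exists (A g / (1 - q)).
  rewrite divr_ge0 ?subr_ge0 ?(ltW q1)// !mulr_ge0 ?powR_ge0//.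
  exact: upper_regular_ge0.
move=> x s s0.
apply: le_trans (@integral_riesz_dyadic g x (eball x s) xpredT
  (fun k => s * 2^-1 ^+ k) _ _ _) _.
- by apply: measurable_open_area; exact: open_eball.
- by move=> k; rewrite mulr_gt0// exprn_gt0// invr_gt0.
- move=> y Gy; rewrite /eball/= (enormB y x) => ys xy.
  have [|k /andP[k1 k2]] := @dyadic_scale_lt _ s (enorm (x - y)) _ ys.
    by rewrite enorm_sub_gt0.
  by exists k.
have -> : A g / (1 - q) * s `^ a = (A g * s `^ a) / (1 - q) by rewrite mulrAC.
apply: le_trans (nneseries_geometric_le _ q0 q1); last first.
  rewrite !mulr_ge0 ?powR_ge0//; exact: upper_regular_ge0.
apply: lee_nneseries => [k _ _|k _].
  rewrite lee_fin !mulr_ge0 ?powR_ge0 ?exprn_ge0 ?invr_ge0//.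
  exact: upper_regular_ge0.
rewrite lee_fin mul1r powRM ?exprn_ge0 ?invr_ge0 ?(ltW s0)//.
by rewrite powR_exprn ?invr_ge0// mulrA.
Qed.

(** The scales 2 ^ k * s give a geometric series of ratio 2 ^ (m - g) < 1. *)
Lemma integral_riesz_far g : m%:R < g -> exists2 B, 0 <= B &
  forall x s, 0 < s ->
  (\int[area]_(y in G) (\1_(~` eball x s) y * riesz g x y)%:E <=
   (B * s `^ (m%:R - g))%:E)%E.
Proof.
move=> gm; pose a : R := m%:R - g; have a0 : a < 0 by rewrite subr_lt0.
pose q : R := 2 `^ a.
have q0 : 0 < q by rewrite powR_gt0.
have q1 : q < 1.
  rewrite /q -[a]opprK powRN invf_lt1 ?powR_gt0//.
  rewrite [ltLHS](_ : 1 = 1 `^ (- a)); last by rewrite powR1.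
  by rewrite gt0_ltr_powR ?nnegrE ?oppr_gt0// ltr1n.
exists (A g / (1 - q)).
  rewrite divr_ge0 ?subr_ge0 ?(ltW q1)// !mulr_ge0 ?powR_ge0//.
  exact: upper_regular_ge0.
move=> x s s0.
apply: le_trans (@integral_riesz_dyadic g x (~` eball x s) xpredT
  (fun k => s * 2 ^+ k) _ _ _) _.
- by apply: measurableC; apply: measurable_open_area; exact: open_eball.
- by move=> k; rewrite mulr_gt0// exprn_gt0.
- move=> y Gy; rewrite /eball/= (enormB y x) => /negP; rewrite -leNgt => ys xy.
  have [k [k1 k2 _]] := dyadic_scale_ge s0 ys.
  by exists k.
have -> : A g / (1 - q) * s `^ a = (A g * s `^ a) / (1 - q) by rewrite mulrAC.
apply: le_trans (nneseries_geometric_le _ q0 q1); last first.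
  rewrite !mulr_ge0 ?powR_ge0//; exact: upper_regular_ge0.
apply: lee_nneseries => [k _ _|k _].
  rewrite lee_fin !mulr_ge0 ?powR_ge0 ?exprn_ge0//.
  exact: upper_regular_ge0.
rewrite lee_fin mul1r powRM ?exprn_ge0 ?(ltW s0)//.
by rewrite powR_exprn// mulrA.
Qed.

(** In the critical case every dyadic shell contributes the same amount, so
    the integral is controlled by the number of shells. *)
Lemma integral_riesz_log (d : R) :
  (forall x y, G x -> G y -> enorm (x - y) < d) -> exists2 B, 0 <= B &
  forall x s, G x -> 0 < s -> s <= d ->
  (\int[area]_(y in G) (\1_(~` eball x s) y * riesz m%:R x y)%:E <=
   (B * (1 + ln (d / s)))%:E)%E.
Proof.
move=> Gd; exists (A m%:R * (1 + (ln 2)^-1)).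
  rewrite !mulr_ge0 ?powR_ge0//; first exact: upper_regular_ge0.
  by rewrite addr_ge0// invr_ge0 ln_ge0// ler1n.
move=> x s Gx s0 sd; have d0 := lt_le_trans s0 sd.
have ln20 : 0 < ln 2 :> R by rewrite ln_gt0// ltr1n.
(* The shells beyond the N-th one are farther from x than d: they miss G. *)
pose N := (Num.truncn (ln (d / s) / ln 2)).+1.
apply: le_trans (@integral_riesz_dyadic m%:R x (~` eball x s)
  (fun k => k < N)%N (fun k => s * 2 ^+ k) _ _ _) _.
- by apply: measurableC; apply: measurable_open_area; exact: open_eball.
- by move=> k; rewrite mulr_gt0// exprn_gt0.
- move=> y Gy; rewrite /eball/= (enormB y x) => /negP; rewrite -leNgt => ys xy.
  have [k [k1 k2 k3]] := dyadic_scale_ge s0 ys.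
  exists k; split => //; rewrite ltnS truncn_ge_nat; last first.
    by rewrite divr_ge0 ?(ltW ln20)// ln_ge0// ler_pdivlMr// mul1r.
  rewrite ler_pdivlMr// mulr_natl -lnXn// ler_ln ?posrE ?exprn_gt0 ?divr_gt0//.
  by rewrite ler_pdivlMr// mulrC; apply: le_trans k3 _; rewrite ltW// Gd.
rewrite (nneseries_split 0 N)//; last first.
  move=> k _; rewrite lee_fin !mulr_ge0 ?powR_ge0//; exact: upper_regular_ge0.
rewrite [X in (_ + X)%E]eseries0; last first.
  by move=> k; rewrite add0n leqNgt => /negbTE ->; rewrite mul0r.
rewrite adde0 add0n big_mkord sumEFin lee_fin.
rewrite (eq_bigr (fun=> A m%:R)); last first.
  by move=> k _; rewrite ltn_ord mul1r subrr powRr0 mulr1.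
rewrite sumr_const card_ord -[leLHS]mulr_natr -[leRHS]mulrA.
rewrite ler_wpM2l//.
  rewrite !mulr_ge0 ?powR_ge0//; exact: upper_regular_ge0.
have lns0 : 0 <= ln (d / s) by rewrite ln_ge0// ler_pdivlMr// mul1r.
rewrite mulrDr mulr1 mulrDl mul1r.
have : N%:R <= ln (d / s) / ln 2 + 1.
  by rewrite -[leLHS]natr1 lerD2r truncn_le divr_ge0// ltW.
have : 0 <= (ln 2)^-1 :> R by rewrite invr_ge0 ltW.
lra.
Qed.

End surface_integrals.

(** * Complex-valued integrals over a closed set *)

Section complex_numbers.
Context {R : realType}.
Implicit Types z w : R[i].
Local Notation normc := Normc.normc.
Local Notation Re := complex.Re.
Local Notation Im := complex.Im.

Lemma normc_ge0 z : 0 <= normc z.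
Proof. by case: z => a b; exact: sqrtr_ge0. Qed.

Lemma normrE_complex z : `|z| = (normc z)%:C%C.
Proof. by []. Qed.

Lemma Re_le_normc z : `|Re z| <= normc z.
Proof.
case: z => a b /=; rewrite -sqrtr_sqr ler_sqrt ?addr_ge0 ?sqr_ge0//.
by rewrite lerDl sqr_ge0.
Qed.

Lemma Im_le_normc z : `|Im z| <= normc z.
Proof.
case: z => a b /=; rewrite -sqrtr_sqr ler_sqrt ?addr_ge0 ?sqr_ge0//.
by rewrite lerDr sqr_ge0.
Qed.

Lemma normc_le_ReIm z : normc z <= `|Re z| + `|Im z|.
Proof.
case: z => a b /=; rewrite -(@ler_pXn2r _ 2)// ?nnegrE ?addr_ge0 ?sqrtr_ge0//.
rewrite sqr_sqrtr ?addr_ge0 ?sqr_ge0// sqrrD !real_normK ?num_real//.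
by rewrite addrAC lerDl mulrn_wge0// mulr_ge0.
Qed.

Lemma ReM z w : Re (z * w) = Re z * Re w - Im z * Im w.
Proof. by case: z => a b; case: w => c d. Qed.

Lemma ImM z w : Im (z * w) = Re z * Im w + Im z * Re w.
Proof. by case: z => a b; case: w => c d. Qed.

Lemma ReD z w : Re (z + w) = Re z + Re w.
Proof. by case: z => a b; case: w => c d. Qed.

Lemma ImD z w : Im (z + w) = Im z + Im w.
Proof. by case: z => a b; case: w => c d. Qed.

Lemma eq_ReIm z w : Re z = Re w -> Im z = Im w -> z = w.
Proof. by case: z => a b; case: w => c d /= -> ->. Qed.

Lemma ler_normcB w z v : normc (z - v) <= normc (z - w) + normc (w - v).
Proof. by have := le_normcD (z - w) (w - v); rewrite addrA subrK. Qed.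

End complex_numbers.

Section dominated_integrals.
Context d (T : measurableType d) (R : realType).
Variable mu : {measure set T -> \bar R}.

Lemma ae_imply (P Q : T -> Prop) : (forall y, P y -> Q y) ->
  (\forall y \ae mu, P y) -> \forall y \ae mu, Q y.
Proof. by move=> PQ; apply: filterS. Qed.

Lemma ae_and (P Q : T -> Prop) : (\forall y \ae mu, P y) ->
  (\forall y \ae mu, Q y) -> \forall y \ae mu, P y /\ Q y.
Proof. exact: filterI. Qed.

Lemma integrable_dominated (G : set T) (f h : T -> R) (B : R) : measurable G ->
  measurable_fun G f -> measurable_fun G h ->
  (forall y, 0 <= h y) ->
  (\forall y \ae mu, G y -> `|f y| <= h y) ->
  (\int[mu]_(y in G) (h y)%:E <= B%:E)%E ->
  mu.-integrable G (fun y => (f y)%:E) /\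
  `|\int[mu]_(y in G) f y| <= B.
Proof.
move=> mG mf mh h0 fh hB.
have int_abs : (\int[mu]_(y in G) `|(f y)%:E| <= B%:E)%E.
  apply: le_trans hB; apply: ae_ge0_le_integral => //.
  - by apply: measurableT_comp => //; exact/measurable_EFinP.
  - by move=> y _; rewrite lee_fin.
  - exact/measurable_EFinP.
have intf : mu.-integrable G (fun y => (f y)%:E).
  apply/integrableP; split; first exact/measurable_EFinP.
  by apply: le_lt_trans int_abs _; exact: ltry.
split => //; apply: le_trans (le_normr_Rintegral mG intf) _.
rewrite -lee_fin /Rintegral fineK//.
rewrite ge0_fin_numE ?integral_ge0//.
by apply: le_lt_trans int_abs _; exact: ltry.
Qed.

Lemma Rintegral_lin3 (G : set T) (a b : R) (f1 f2 f3 : T -> R) : measurable G ->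
  mu.-integrable G (EFin \o f1) -> mu.-integrable G (EFin \o f2) ->
  mu.-integrable G (EFin \o f3) ->
  \int[mu]_(y in G) (a * f1 y + b * f2 y + f3 y) =
  a * (\int[mu]_(y in G) f1 y) + b * (\int[mu]_(y in G) f2 y) +
  \int[mu]_(y in G) f3 y.
Proof.
move=> mG i1 i2 i3.
have iZ c f : mu.-integrable G (EFin \o f) ->
    mu.-integrable G (EFin \o (fun y => c * f y)).
  by move=> ?; rewrite (_ : _ \o _ = (fun y => c%:E * (EFin \o f) y)%E)//;
    exact: integrableZl.
have iD : mu.-integrable G (EFin \o (fun y => a * f1 y + b * f2 y)).
  exact: (integrableD mG (iZ a f1 i1) (iZ b f2 i2)).
rewrite RintegralD// RintegralD//; try exact: iZ.
by rewrite !RintegralZl.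
Qed.

End dominated_integrals.

Section complex_integrals.
Context {R : realType} {n : nat}.
Local Notation E := 'rV[R]_n.
Local Notation T := (caratheodory_type (@hausdorff R n n.-1)).
Local Notation normc := Normc.normc.
Local Notation Re := complex.Re.
Local Notation Im := complex.Im.
Context (G : set E) (mG : measurable (G : set T)).

(** The factor 2 comes from bounding the modulus of the integral by the sum of
    the absolute values of its real and imaginary parts. *)
Lemma cintegrable_dominated (f : E -> R[i]) (h : E -> R) (B : R) :
  cmeasurable G f -> measurable_fun (G : set T) h -> (forall y, 0 <= h y) ->
  (\forall y \ae area, G y -> normc (f y) <= h y) ->
  (\int[area]_(y in G) (h y)%:E <= B%:E)%E ->
  cintegrable G f /\ normc (cintegral G f) <= 2 * B.
Proof.
move=> [mRe mIm] mh h0 fh hB.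
have [|iRe bRe] := integrable_dominated mG mRe mh h0 _ hB.
  by apply: ae_imply fh => y fy Gy; apply: le_trans (Re_le_normc _) (fy Gy).
have [|iIm bIm] := integrable_dominated mG mIm mh h0 _ hB.
  by apply: ae_imply fh => y fy Gy; apply: le_trans (Im_le_normc _) (fy Gy).
split => //; apply: le_trans (normc_le_ReIm _) _.
by rewrite mulr_natl mulr2n lerD.
Qed.

Lemma cintegralZD (c : R[i]) (f g : E -> R[i]) :
  cintegrable G f -> cintegrable G g ->
  cintegral G (fun y => c * f y + g y) = c * cintegral G f + cintegral G g.
Proof.
move=> [iRf iIf] [iRg iIg]; apply: eq_ReIm.
  rewrite ReD ReM /= -[in RHS]mulNr -Rintegral_lin3//.
  by apply: eq_Rintegral => y _; rewrite ReD ReM mulNr.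
rewrite ImD ImM /= -Rintegral_lin3//.
by apply: eq_Rintegral => y _; rewrite ImD ImM.
Qed.

Lemma cintegralB (f g : E -> R[i]) :
  cintegrable G f -> cintegrable G g ->
  cintegral G (fun y => f y - g y) = cintegral G f - cintegral G g.
Proof.
move=> fi gi; rewrite [RHS]addrC -[X in X + _]mulN1r -cintegralZD//.
by congr cintegral; apply/funext => y; rewrite mulN1r addrC.
Qed.

Lemma cmeasurableM (f g : E -> R[i]) :
  cmeasurable G f -> cmeasurable G g -> cmeasurable G (fun y => f y * g y).
Proof.
move=> [fR fI] [gR gI]; split.
  under eq_fun do rewrite ReM.
  by apply: measurable_funB; exact: measurable_funM.
under eq_fun do rewrite ImM.
by apply: measurable_funD; exact: measurable_funM.
Qed.

Lemma cmeasurableB (f g : E -> R[i]) :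
  cmeasurable G f -> cmeasurable G g -> cmeasurable G (fun y => f y - g y).
Proof.
move=> [fR fI] [gR gI]; split.
  rewrite (_ : (fun y => _) = (fun y => Re (f y) - Re (g y))).
    exact: measurable_funB.
  by apply/funext => y; case: (f y) => a b; case: (g y).
rewrite (_ : (fun y => _) = (fun y => Im (f y) - Im (g y))).
  exact: measurable_funB.
by apply/funext => y; case: (f y) => a b; case: (g y).
Qed.

(** The L^oo norm is an essential supremum when the whole space has positive
    measure; when it is null, every property holds almost everywhere. *)
Lemma linfty_norm_bound (mu : E -> R[i]) (N : R) :
  (linfty_norm G mu <= N%:E)%E ->
  \forall y \ae area, G y -> normc (mu y) <= N.
Proof.
rewrite /linfty_norm unlock; case: ifPn => [_|].
  move=> /ess_supP h; apply: ae_imply h => y /= h Gy.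
  by move: h; rewrite patchE mem_set// lee_fin ger0_norm ?normc_ge0.
rewrite -leNgt => muT0 _; exists setT; split => //.
by apply/eqP; rewrite eq_le muT0 measure_ge0.
Qed.

End complex_integrals.

(** * Bounds for the potentials *)

Section sup0_facts.
Context {R : realType}.

Lemma sup0_ub (A : set R) a : A a -> (a%:E <= Defs.sup0 A)%E.
Proof. by move=> Aa; apply: ereal_sup_ubound; right; exists a. Qed.

Lemma sup0_ge0 (A : set R) : (0 <= Defs.sup0 A)%E.
Proof. by apply: ereal_sup_ubound; left. Qed.

Lemma sup0_le (A : set R) b : 0 <= b -> (forall a, A a -> a <= b) ->
  (Defs.sup0 A <= b%:E)%E.
Proof.
by move=> b0 Ab; apply: ge_ereal_sup => _ [->|[a Aa <-]]; rewrite lee_fin//; exact: Ab.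
Qed.

End sup0_facts.

Section nonnegative_integral_bounds.
Context d (T : measurableType d) (R : realType).
Variable mu : {measure set T -> \bar R}.
Context (D : set T) (mD : measurable D).
Implicit Types (f g : T -> R) (a b c : R).

Lemma integralD_le f g a b : measurable_fun D f -> measurable_fun D g ->
  (forall y, 0 <= f y) -> (forall y, 0 <= g y) ->
  (\int[mu]_(y in D) (f y)%:E <= a%:E)%E ->
  (\int[mu]_(y in D) (g y)%:E <= b%:E)%E ->
  (\int[mu]_(y in D) (f y + g y)%:E <= (a + b)%:E)%E.
Proof.
move=> mf mg f0 g0 fa gb; under eq_integral do rewrite EFinD.
rewrite ge0_integralD//; first by rewrite EFinD leeD.
- by move=> y _; rewrite lee_fin.
- exact/measurable_EFinP.
- by move=> y _; rewrite lee_fin.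
- exact/measurable_EFinP.
Qed.

Lemma integralZ_le c f a : measurable_fun D f -> (forall y, 0 <= f y) ->
  0 <= c -> (\int[mu]_(y in D) (f y)%:E <= a%:E)%E ->
  (\int[mu]_(y in D) (c * f y)%:E <= (c * a)%:E)%E.
Proof.
move=> mf f0 c0 fa; under eq_integral do rewrite EFinM.
rewrite ge0_integralZl//; first by rewrite EFinM lee_wpmul2l.
- exact/measurable_EFinP.
- by move=> y _; rewrite lee_fin.
Qed.

Lemma integral_cst_le c a : 0 <= c -> (mu D <= a%:E)%E ->
  (\int[mu]_(y in D) c%:E <= (c * a)%:E)%E.
Proof.
move=> c0 Da; rewrite (integral_cst mu mD c%:E) EFinM.
by apply: lee_wpmul2l; rewrite ?lee_fin.
Qed.

End nonnegative_integral_bounds.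

Section potentials.
Context {R : realType} {n : nat}.
Local Notation E := 'rV[R]_n.
Local Notation T := (caratheodory_type (@hausdorff R n n.-1)).
Local Notation normc := Normc.normc.
Context (G : set E) (C : R).
Context (closedG : closed G) (regG : upper_regular n.-1 G C) (n2 : (2 <= n)%N).
Implicit Types (K : E -> E -> R[i]) (mu : E -> R[i]).

Let mG : measurable (G : set T).
Proof. exact: measurable_closed_area. Qed.

Lemma kernel_bound g1 g2 g3 K (M : R) : (kernel_norm g1 g2 g3 G K <= M%:E)%E ->
  forall x y, G x -> G y -> x != y -> normc (K x y) <= M * riesz g1 x y.
Proof.
move=> KM x y Gx Gy xy; rewrite /riesz (negbTE xy) powRN.
rewrite ler_pdivlMr ?powR_gt0 ?enorm_sub_gt0// mulrC -lee_fin.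
apply: le_trans KM; apply: le_trans (leeDl _ (sup0_ge0 _)).
by apply: sup0_ub; exists x, y.
Qed.

Lemma kernel_difference_bound g1 g2 g3 K (M : R) :
  (kernel_norm g1 g2 g3 G K <= M%:E)%E ->
  forall x x' y, G x -> G x' -> x != x' -> G y ->
  ~ eball x (2 * enorm (x - x')) y ->
  normc (K x y - K x' y) <= M * (enorm (x - x') `^ g3 * riesz g2 x y).
Proof.
move=> KM x x' y Gx Gx' xx' Gy yB.
have xy : x != y.
  apply/eqP => xy; apply: yB; rewrite /eball/= xy subrr enorm0.
  by rewrite mulr_gt0// enorm_sub_gt0 -xy.
have p2 : 0 < enorm (x - y) `^ g2 by rewrite powR_gt0// enorm_sub_gt0.
have p3 : 0 < enorm (x - x') `^ g3 by rewrite powR_gt0// enorm_sub_gt0.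
rewrite /riesz (negbTE xy) powRN mulrA (ler_pdivlMr _ _ p2).
rewrite -(ler_pdivrMr _ _ p3) -lee_fin.
apply: le_trans KM; apply: le_trans (leeDr _ (sup0_ge0 _)).
apply: sup0_ub; exists x, x', y; split => //.
by rewrite [RHS]mulrC mulrA.
Qed.

Lemma kernel_near K x y (e : R) :
  {within (G `*` G) `\` [set p | p.1 = p.2],
    continuous (fun p : E * E => K p.1 p.2 : R[i]^o)} ->
  G x -> G y -> x != y -> 0 < e ->
  exists A B : set E, [/\ nbhs x A, nbhs y B &
    forall x' y', A x' -> B y' -> G x' -> G y' -> x' != y' ->
    normc (K x' y' - K x y) < e].
Proof.
move=> /subspace_continuousP cK Gx Gy xy e0.
have := cK (x, y) (conj (conj Gx Gy) (elimN eqP xy)).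
move=> /(@cvgrPdist_lt _ _ _ (within _ (nbhs (x, y))))/(_ e%:C%C).
rewrite ltcR => /(_ e0) [[A B] /= [nA nB] AB].
exists A, B; split => // x' y' Ax By Gx' Gy' xy'.
have := AB (x', y') (conj Ax By) (conj (conj Gx' Gy') (elimN eqP xy')).
by rewrite distrC normrE_complex ltcR.
Qed.

(** The function K x is continuous on G without x, and any function is
    measurable on the singleton that remains. *)
Lemma cmeasurable_kernel K x :
  {within (G `*` G) `\` [set p | p.1 = p.2],
    continuous (fun p : E * E => K p.1 p.2 : R[i]^o)} ->
  G x -> cmeasurable G (K x).
Proof.
move=> cK Gx; have mx := measurable_set1_area x.
have mD : measurable (G `\` [set x] : set T) by exact: measurableD.
suff h (p : R[i] -> R) : (forall z w, `|p z - p w| <= normc (z - w)) ->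
    measurable_fun (G : set T) (fun y => p (K x y)).
  split; apply: h => -[a b] [c d].
    exact: (Re_le_normc ((a +i* b) - (c +i* d))%C).
  exact: (Im_le_normc ((a +i* b) - (c +i* d))%C).
move=> p_lip.
have -> : (G : set T) = (G `\` [set x]) `|` [set x].
  by rewrite setUC setDUK// => _ ->.
apply/(measurable_funU _ mD mx); split; last exact: measurable_fun_set1.
apply: (measurable_within_continuous mD).
apply/subspace_continuousP => y [Gy yx].
apply/(@cvgrPdist_lt _ _ _ (within _ (nbhs y))) => e e0.
have xy : x != y by apply/eqP => xy; apply: yx.
have [A [B [nA nB AB]]] := kernel_near cK Gx Gy xy e0.
apply: filterS nB => z Bz [Gz zx].
apply: le_lt_trans (p_lip _ _) _; rewrite -normcN opprB.
apply: AB => //; first exact: nbhs_singleton.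
by apply/eqP => xz; apply: zx.
Qed.

(** The part of G outside the ball is compact and off the diagonal from x, so
    the continuity of the kernel in its first argument is uniform there. *)
Lemma kernel_uniform K x (s e : R) : compact G ->
  {within (G `*` G) `\` [set p | p.1 = p.2],
    continuous (fun p : E * E => K p.1 p.2 : R[i]^o)} ->
  G x -> 0 < s -> 0 < e ->
  \forall x' \near x, G x' -> forall y, G y -> ~ eball x s y ->
    normc (K x' y - K x y) <= e.
Proof.
move=> cG cK Gx s0 e0.
have cA : compact (G `\` eball x s).
  apply: (subclosed_compact _ cG); last by move=> y [].
  by rewrite setDE; apply: closedI => //; apply: open_closedC; exact: open_eball.
have e20 : 0 < e / 2 by rewrite divr_gt0.
have xs : eball x s x by exact: eball_center.
have /compact_near_coveringP nc := cA.
have neq x' y : eball x s x' -> ~ eball x s y -> x' != y.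
  by move=> x's yNs; apply: contra_notN yNs => /eqP <-.
have near_all := nc _ (nbhs x) (fun x' y => eball x s x' -> G x' -> G y ->
  ~ eball x s y -> normc (K x' y - K x y) <= e) (nbhs_filter x).
have := nbhs_eball x s0.
apply: filterS2 (near_all _) => [x' h x's Gx' y Gy yNs|y [Gy yNs]]; last first.
  have [A [B [nA nB AB]]] := kernel_near cK Gx Gy (neq _ _ xs yNs) e20.
  exists (B, A) => // -[y' x'] [/= By' Ax'] x's Gx' Gy' y'Ns.
  have Ax := nbhs_singleton nA.
  apply: le_trans (ler_normcB (K x y) _ _) _.
  rewrite [leRHS]splitr; apply: lerD; first exact/ltW/AB/neq.
  by rewrite -normcN opprB; apply/ltW/AB => //; exact: neq.
by apply: h.
Qed.

(** Shrinking balls: the exponent n.-1 in their area is positive. *)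
Lemma area_set1 x : hausdorff n.-1 (G `&` [set x]) = 0%E.
Proof.
apply/eqP; rewrite eq_le outer_measure_ge0 andbT.
apply/lee_addgt0Pr => e e0; rewrite add0e.
have C0 := upper_regular_ge0 regG.
pose s := Num.min 1 (e / (C + 1)).
have s0 : 0 < s by rewrite lt_min ltr01 divr_gt0// ltr_wpDl.
apply: (@le_trans _ _ (hausdorff n.-1 (G `&` eball x s))).
  apply: le_outer_measure => y [Gy yx]; split => //.
  by rewrite yx; exact: eball_center.
apply: le_trans (regG x s0) _; rewrite lee_fin.
apply: (@le_trans _ _ ((C + 1) * s)); last first.
  by rewrite mulrC -ler_pdivlMr ?ltr_wpDl// ge_min lexx orbT.
apply: ler_pM => //; rewrite ?exprn_ge0 ?(ltW s0)// ?lerDl//.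
have -> : (n.-1 = n.-2.+1)%N by case: n n2 => [|[]].
rewrite exprS ler_piMr ?(ltW s0)// exprn_ile1 ?(ltW s0)//.
by rewrite ge_min lexx.
Qed.

Lemma ae_neq x : \forall y \ae @area R n, G y -> x != y.
Proof.
exists (G `&` [set x] : set T); split.
- by apply: measurableI => //; exact: measurable_set1_area.
- exact: area_set1.
move=> y /= /not_implyP[Gy /negP]; rewrite negbK => /eqP xy.
by split => //; exact/esym.
Qed.

Section kernel_and_density.
Context (g1 g2 g3 : R) (K : E -> E -> R[i]) (mu : E -> R[i]) (M N B : R).
Context (cK : {within (G `*` G) `\` [set p | p.1 = p.2],
  continuous (fun p : E * E => K p.1 p.2 : R[i]^o)}).
Context (KM : (kernel_norm g1 g2 g3 G K <= M%:E)%E) (M0 : 0 <= M).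
Context (mmu : cmeasurable G mu) (muN : (linfty_norm G mu <= N%:E)%E) (N0 : 0 <= N).
Context (nearB : forall x s, 0 < s ->
  (\int[area]_(y in G) (\1_(eball x s) y * riesz g1 x y)%:E <=
   (B * s `^ (n.-1%:R - g1))%:E)%E).

Lemma potential_bounded d x : 0 < d ->
  (forall y, G y -> enorm (y - x) < d) -> G x ->
  cintegrable G (fun y => K x y * mu y) /\
  normc (potential G K mu x) <= 2 * (N * (M * (B * d `^ (n.-1%:R - g1)))).
Proof.
move=> d0 Gd Gx.
have mB : measurable (eball x d : set T).
  by apply: measurable_open_area; exact: open_eball.
have mr := measurable_trunc_riesz g1 x mB (D := G).
pose h y := N * (M * (\1_(eball x d) y * riesz g1 x y)).
have r0 y : 0 <= \1_(eball x d) y * riesz g1 x y.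
  by rewrite mulr_ge0 ?riesz_ge0.
have mZ c (f : T -> R) : measurable_fun (G : set T) f ->
    measurable_fun (G : set T) (fun y => c * f y).
  by move=> mf; apply: measurable_funM mf; exact: measurable_cst.
apply: (@cintegrable_dominated _ _ _ mG _ h).
- exact: (cmeasurableM (cmeasurable_kernel cK Gx) mmu).
- exact: (mZ N _ (mZ M _ mr)).
- by move=> y; rewrite !mulr_ge0 ?riesz_ge0.
- apply: ae_imply (ae_and (ae_neq x) (linfty_norm_bound muN)) => y [xy yN] Gy.
  rewrite Normc.normcM mulrC; apply: ler_pM; rewrite ?normc_ge0//; first exact: yN.
  rewrite indicE mem_set ?mul1r; last exact: Gd.
  by apply: (kernel_bound KM) => //; exact: xy.
have Mr0 y : 0 <= M * (\1_(eball x d) y * riesz g1 x y) by rewrite mulr_ge0.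
apply: (integralZ_le mG (mZ M _ mr) Mr0 N0).
exact: (integralZ_le mG mr r0 M0 (nearB _ d0)).
Qed.

(** In the ball of radius s around x, which the ball of radius s' around x'
    contains, the two kernels are estimated separately by their singularities;
    outside it their difference is estimated by t. *)
Lemma potential_difference d x x' s s' (t : E -> R) (b : R) :
  0 < d -> (forall y z, G y -> G z -> enorm (y - z) < d) ->
  G x -> G x' -> 0 < s -> 0 < s' -> eball x s `<=` eball x' s' ->
  measurable_fun (G : set T) t -> (forall y, 0 <= t y) ->
  (\int[area]_(y in G) (t y)%:E <= b%:E)%E ->
  (forall y, G y -> ~ eball x s y -> normc (K x y - K x' y) <= t y) ->
  normc (potential G K mu x - potential G K mu x') <=
  2 * (N * (M * (B * s `^ (n.-1%:R - g1) + B * s' `^ (n.-1%:R - g1)) + b)).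
Proof.
move=> d0 Gd Gx Gx' s0 s'0 sub mt t0 tb tK.
have [ix _] := potential_bounded d0 (fun y Gy => Gd y x Gy Gx) Gx.
have [ix' _] := potential_bounded d0 (fun y Gy => Gd y x' Gy Gx') Gx'.
rewrite /potential -cintegralB//.
have mB (y : E) r : measurable (eball y r : set T).
  by apply: measurable_open_area; exact: open_eball.
have mr z r := measurable_trunc_riesz g1 z (mB z r) (D := G).
have r0 (z : E) r y : 0 <= \1_(eball z r) y * riesz g1 z y.
  by rewrite mulr_ge0 ?riesz_ge0.
pose h y := N * (M * (\1_(eball x s) y * riesz g1 x y +
                      \1_(eball x' s') y * riesz g1 x' y) + t y).
have mZ c (f : T -> R) : measurable_fun (G : set T) f ->
    measurable_fun (G : set T) (fun y => c * f y).
  by move=> mf; apply: measurable_funM mf; exact: measurable_cst.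
have mD (f g : T -> R) : measurable_fun (G : set T) f ->
    measurable_fun (G : set T) g -> measurable_fun (G : set T) (fun y => f y + g y).
  by move=> mf mg; exact: measurable_funD.
have m1 := mD _ _ (mr x s) (mr x' s').
have m2 := mD _ _ (mZ M _ m1) mt.
apply: (cintegrable_dominated mG (h := h) _ _ _ _ _).2.
- apply: cmeasurableB.
    exact: (cmeasurableM (cmeasurable_kernel cK Gx) mmu).
  exact: (cmeasurableM (cmeasurable_kernel cK Gx') mmu).
- exact: (mZ N _ m2).
- by move=> y; rewrite mulr_ge0// addr_ge0// mulr_ge0// addr_ge0.
- apply: ae_imply (ae_and (ae_and (ae_neq x) (ae_neq x')) (linfty_norm_bound muN)).
  move=> y [[xy x'y] yN] Gy.
  rewrite -mulrBl Normc.normcM mulrC; apply: ler_pM; rewrite ?normc_ge0//.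
    exact: yN.
  have [ys|ys] := pselect (eball x s y); last first.
    by apply: le_trans (tK _ Gy ys) _; rewrite lerDr mulr_ge0// addr_ge0.
  apply: ler_wpDr; first exact: t0.
  have -> : \1_(eball x s) y * riesz g1 x y = riesz g1 x y.
    by rewrite indicE mem_set// mul1r.
  have -> : \1_(eball x' s') y * riesz g1 x' y = riesz g1 x' y.
    by rewrite indicE mem_set ?mul1r//; exact: sub.
  rewrite mulrDr; apply: le_trans (le_normcD _ _) _; rewrite normcN.
  by apply: lerD; apply: (kernel_bound KM) => //; [exact: xy|exact: x'y].
have rr0 y : 0 <= \1_(eball x s) y * riesz g1 x y +
    \1_(eball x' s') y * riesz g1 x' y by rewrite addr_ge0.
have Mr0 y : 0 <= M * (\1_(eball x s) y * riesz g1 x y +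
    \1_(eball x' s') y * riesz g1 x' y) by rewrite mulr_ge0.
have h0 y : 0 <= M * (\1_(eball x s) y * riesz g1 x y +
    \1_(eball x' s') y * riesz g1 x' y) + t y by rewrite addr_ge0.
apply: (integralZ_le mG m2 h0 N0).
apply: (integralD_le mG (mZ M _ m1) mt Mr0 t0 _ tb).
apply: (integralZ_le mG m1 rr0 M0).
exact: (integralD_le mG (mr x s) (mr x' s') (r0 x s) (r0 x' s')
  (nearB _ s0) (nearB _ s'0)).
Qed.

End kernel_and_density.

End potentials.

(** * Continuity and moduli of continuity of the potentials *)

Lemma ltr_pMdiv1 {R : realFieldType} (q e : R) : 0 <= q -> 0 < e ->
  q * (e / (q + 1)) < e.
Proof.
move=> q0 e0; have q1 : 0 < q + 1 by rewrite ltr_wpDl.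
by rewrite mulrA ltr_pdivrMr// mulrC mulrDr mulr1 ltrDl.
Qed.

Section regularity.
Context {R : realType} {n : nat}.
Local Notation E := 'rV[R]_n.
Local Notation T := (caratheodory_type (@hausdorff R n n.-1)).
Local Notation normc := Normc.normc.
Context (G : set E) (C d : R).
Context (cG : compact G) (closedG : closed G).
Context (regG : upper_regular n.-1 G C) (n2 : (2 <= n)%N).
Context (d0 : 0 < d) (Gd : forall x y, G x -> G y -> enorm (x - y) < d).
Context (g1 g2 g3 : R) (g1m : g1 < n.-1%:R).
Implicit Types (K : E -> E -> R[i]) (mu : E -> R[i]).

Let mG : measurable (G : set T).
Proof. exact: measurable_closed_area. Qed.

Let a := n.-1%:R - g1.

Let a0 : 0 < a.
Proof. by rewrite subr_gt0. Qed.

Lemma area_le x : G x -> (@area R n G <= (C * d ^+ n.-1)%:E)%E.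
Proof.
move=> Gx; apply: le_trans (regG x d0).
by apply: le_outer_measure => y Gy; split => //; exact: Gd.
Qed.

Section continuity.
Context (K : E -> E -> R[i]) (mu : E -> R[i]) (M N : R).
Context (cK : {within (G `*` G) `\` [set p | p.1 = p.2],
  continuous (fun p : E * E => K p.1 p.2 : R[i]^o)}).
Context (KM : (kernel_norm g1 g2 g3 G K <= M%:E)%E) (M0 : 0 <= M).
Context (mmu : cmeasurable G mu) (muN : (linfty_norm G mu <= N%:E)%E) (N0 : 0 <= N).

(** The contribution of the balls of radius s and 2 s around x and x' is of order
    s ^ a with a > 0, so it is at most half of the tolerance e for the s chosen
    below.  For this s the kernels K x' converge to K x uniformly outside the
    ball. *)
Lemma potential_continuous :
  {within G, continuous (potential G K mu : E -> R[i]^o)}.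
Proof.
apply/subspace_continuousP => x Gx.
apply/(@cvgrPdist_lt _ _ _ (within _ (nbhs x))) => e'.
rewrite ltcE/= => /andP[/eqP e'0 e0]; pose e := complex.Re e'.
have [B B0 nearB] := integral_riesz_near closedG regG g1m.
(* The balls contribute Q * s ^ a and the rest of G, whose area is at most V,
   contributes 2 * N * V * eta; both are less than e / 2. *)
pose Q := 2 * (N * (M * (B * (1 + 2 `^ a)))).
have Q0 : 0 <= Q by rewrite !mulr_ge0// addr_ge0// powR_ge0.
pose s := (e / 2 / (Q + 1)) `^ a^-1.
have s0 : 0 < s by rewrite powR_gt0// !divr_gt0// ltr_wpDl.
have sa : s `^ a = e / 2 / (Q + 1).
  rewrite -powRrM mulVf ?gt_eqF// powRr1// !divr_ge0// ?(ltW e0)//.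
  by rewrite addr_ge0.
pose V := C * d ^+ n.-1.
have C0 := upper_regular_ge0 regG.
have V0 : 0 <= V by rewrite mulr_ge0// exprn_ge0// ltW.
have NV0 : 0 <= 2 * (N * V) by rewrite mulr_ge0// mulr_ge0.
have NV1 : 0 < 2 * (N * V) + 1 by rewrite ltr_wpDl.
pose eta := e / 2 / (2 * (N * V) + 1).
have e20 : 0 < e / 2 by rewrite divr_gt0.
have eta0 : 0 < eta by rewrite divr_gt0.
have unif := kernel_uniform closedG cG cK Gx s0 eta0.
apply: filterS2 unif (nbhs_eball x s0) => x' unif x's Gx'.
have -> : e' = (e +i* 0)%C by exact: eq_ReIm.
rewrite normrE_complex ltcR.
have sub : eball x s `<=` eball x' (2 * s).
  move=> y; rewrite /eball/= => ys; apply: le_lt_trans (ler_enorm_dist x _ _) _.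
  by rewrite mulr_natl mulr2n ltrD// enormB.
have tb : (\int[area]_(y in G) (cst eta y)%:E <= (eta * V)%:E)%E.
  by apply: integral_cst_le (ltW eta0) _ => //; exact: (area_le Gx).
apply: le_lt_trans (potential_difference closedG regG n2 cK KM M0 mmu muN N0
  nearB d0 Gd Gx Gx' s0 _ sub _ _ tb _) _.
- by rewrite mulr_gt0.
- exact: measurable_cst.
- by move=> y; rewrite ltW.
- by move=> y Gy ys; rewrite -normcN opprB unif.
rewrite (powRM a) ?(ltW s0)// -/a sa.
rewrite [ltLHS](_ : _ = Q * (e / 2 / (Q + 1)) + 2 * (N * V) * eta); last first.
  by rewrite /Q; ring.
rewrite [ltRHS]splitr; apply: ltrD.
  exact: ltr_pMdiv1.
exact: ltr_pMdiv1.
Qed.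

End continuity.

End regularity.

Section moduli.
Context {R : realType} {n : nat}.
Local Notation E := 'rV[R]_n.
Local Notation T := (caratheodory_type (@hausdorff R n n.-1)).
Local Notation normc := Normc.normc.
Context (G : set E) (C d : R).
Context (closedG : closed G).
Context (regG : upper_regular n.-1 G C) (n2 : (2 <= n)%N).
Context (d0 : 0 < d) (Gd : forall x y, G x -> G y -> enorm (x - y) < d).
Context (g1 g2 g3 : R) (g1m : g1 < n.-1%:R).

Let mG : measurable (G : set T).
Proof. exact: measurable_closed_area. Qed.

Let a : R := n.-1%:R - g1.

Let a0 : 0 < a.
Proof. by rewrite subr_gt0. Qed.

(** The reals M and N bound the norms of the kernel and of the density. *)
Definition sup_estimate (A : R) : Prop :=
  forall K mu M N, kernel_space g1 g2 g3 G K -> linfty_space G mu ->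
  0 <= M -> 0 <= N ->
  (kernel_norm g1 g2 g3 G K <= M%:E)%E -> (linfty_norm G mu <= N%:E)%E ->
  forall x, G x -> normc (potential G K mu x) <= A * (M * N).

Definition modulus_estimate (A : R) (omega : R -> R) : Prop :=
  forall K mu M N, kernel_space g1 g2 g3 G K -> linfty_space G mu ->
  0 <= M -> 0 <= N ->
  (kernel_norm g1 g2 g3 G K <= M%:E)%E -> (linfty_norm G mu <= N%:E)%E ->
  forall x x', G x -> G x' -> x != x' ->
  normc (potential G K mu x - potential G K mu x') <=
    A * (M * N) * omega (enorm (x - x')).

Lemma modulus_estimate_le (A A' : R) (omega omega' : R -> R) : 0 <= A' ->
  (forall r, 0 < r -> r < d -> A * omega r <= A' * omega' r) ->
  modulus_estimate A omega -> modulus_estimate A' omega'.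
Proof.
move=> A'0 le h K mu M N XK Ymu M0 N0 KM muN x x' Gx Gx' xx'.
apply: le_trans (h _ _ _ _ XK Ymu M0 N0 KM muN _ _ Gx Gx' xx') _.
rewrite mulrAC [leRHS]mulrAC ler_wpM2r ?mulr_ge0//.
by apply: le; [rewrite enorm_sub_gt0|exact: Gd].
Qed.

Lemma sup_estimate_exists : exists2 A, 0 <= A & sup_estimate A.
Proof.
have [B B0 nearB] := integral_riesz_near closedG regG g1m.
exists (2 * (B * d `^ a)); first by rewrite !mulr_ge0// powR_ge0.
move=> K mu M N [cK _] [mmu _] M0 N0 KM muN x Gx.
have [_] := potential_bounded closedG regG n2 cK KM M0 mmu muN N0 nearB
  d0 (fun y Gy => Gd Gy Gx) Gx.
rewrite (_ : 2 * (N * _) = 2 * (B * d `^ a) * (M * N))//.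
by rewrite /a; ring.
Qed.

(** For h the distance of x and x', the kernels are estimated separately in the
    ball of radius 2 h around x, which lies in the ball of radius 3 h around x',
    and their difference is estimated outside by the second part of the kernel
    norm.  The first contribution is of order h ^ a, and F bounds the integral
    in the second. *)
Lemma modulus_estimate_far (F : R -> R) : (forall s, 0 < s -> 0 <= F s) ->
  (forall x s, G x -> 0 < s -> s <= 2 * d ->
    (\int[area]_(y in G) (\1_(~` eball x s) y * riesz g2 x y)%:E <=
     (F s)%:E)%E) ->
  exists2 A, 0 <= A &
    modulus_estimate A (fun h => h `^ a + h `^ g3 * F (2 * h)).
Proof.
move=> F0 farF.
have [B B0 nearB] := integral_riesz_near closedG regG g1m.
pose A := 2 * (B * (2 `^ a + 3 `^ a) + 1).
have A0 : 0 <= A by rewrite !(mulr_ge0, addr_ge0)// ?powR_ge0.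
exists A => // K mu M N [cK _] [mmu _] M0 N0 KM muN x x' Gx Gx' xx'.
pose h := enorm (x - x').
have h0 : 0 < h by rewrite enorm_sub_gt0.
have h20 : 0 < 2 * h by rewrite mulr_gt0.
have h30 : 0 < 3 * h by rewrite mulr_gt0.
have hd : h < d by exact: Gd.
have sub : eball x (2 * h) `<=` eball x' (3 * h).
  move=> y; rewrite /eball/= => ys; apply: le_lt_trans (ler_enorm_dist x _ _) _.
  by rewrite -/h; lra.
have mB : measurable (~` eball x (2 * h) : set T).
  by apply: measurableC; apply: measurable_open_area; exact: open_eball.
have mr := measurable_trunc_riesz g2 x mB (D := G).
have r0 y : 0 <= \1_(~` eball x (2 * h)) y * riesz g2 x y.
  by rewrite mulr_ge0 ?riesz_ge0.
pose t y := M * h `^ g3 * (\1_(~` eball x (2 * h)) y * riesz g2 x y).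
have Mh0 : 0 <= M * h `^ g3 by rewrite mulr_ge0 ?powR_ge0.
have mt : measurable_fun (G : set T) t.
  by apply: measurable_funM mr; exact: measurable_cst.
have t0 y : 0 <= t y by rewrite mulr_ge0.
have tF : (\int[area]_(y in G) (t y)%:E <= (M * h `^ g3 * F (2 * h))%:E)%E.
  apply: (integralZ_le mG mr r0 Mh0); apply: farF => //.
  by rewrite ler_pM2l// ltW.
have tK y : G y -> ~ eball x (2 * h) y -> normc (K x y - K x' y) <= t y.
  move=> Gy yB; apply: le_trans (kernel_difference_bound KM Gx Gx' xx' Gy yB) _.
  by rewrite /t indicE mem_set// mul1r -/h mulrA.
apply: le_trans (potential_difference closedG regG n2 cK KM M0 mmu muN N0
  nearB d0 Gd Gx Gx' h20 h30 sub mt t0 tF tK) _.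
rewrite -/a !powRM// ?(ltW h0)//.
set u := h `^ a; set v := h `^ g3 * F (2 * h).
have u0 : 0 <= u by exact: powR_ge0.
have v0 : 0 <= v by rewrite mulr_ge0 ?powR_ge0 ?F0.
have MN0 : 0 <= M * N by rewrite mulr_ge0.
rewrite (_ : 2 * (N * _) = M * N * (2 * (B * (2 `^ a + 3 `^ a) * u + v))); last first.
  by rewrite /u /v; ring.
rewrite [leRHS](_ : _ = M * N * (A * (u + v))); last by rewrite /u /v; ring.
apply: ler_wpM2l => //; rewrite /A.
set c := B * (2 `^ a + 3 `^ a).
have c0 : 0 <= c by rewrite mulr_ge0// addr_ge0// powR_ge0.
by have := mulr_ge0 c0 v0; lra.
Qed.

Lemma powR_le_scale (b c h : R) : b <= c -> 0 < h -> h < d ->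
  h `^ c <= d `^ (c - b) * h `^ b.
Proof.
move=> bc h0 hd; have h0' : h != 0 by rewrite gt_eqF.
have -> : h `^ c = h `^ (c - b) * h `^ b.
  by rewrite -powRD ?h0' ?implybT// subrK.
rewrite ler_wpM2r ?powR_ge0//.
by apply: ge0_ler_powR; rewrite ?nnegrE ?subr_ge0 ?(ltW h0) ?(ltW hd)// ltW.
Qed.

Lemma modulus_estimate_power : n.-1%:R < g2 ->
  let b := Num.min a (n.-1%:R - g2 + g3) in
  exists2 A, 0 <= A & modulus_estimate A (fun h => h `^ b).
Proof.
move=> g2m b.
have [F F0 farF] := integral_riesz_far closedG regG g2m.
have [|x s Gx s0 _|A A0 hA] :=
    @modulus_estimate_far (fun s => F * s `^ (n.-1%:R - g2)).
- by move=> s s0; rewrite mulr_ge0// powR_ge0.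
- exact: farF.
pose a2 := n.-1%:R - g2 + g3.
pose k := d `^ (a - b) + F * 2 `^ (n.-1%:R - g2) * d `^ (a2 - b).
have k0 : 0 <= k by rewrite addr_ge0 ?mulr_ge0 ?powR_ge0.
exists (A * k); first by rewrite mulr_ge0.
apply: modulus_estimate_le hA; first by rewrite mulr_ge0.
move=> h h0 hd /=; rewrite -[leRHS]mulrA ler_wpM2l// [leRHS]mulrDl; apply: lerD.
  by apply: powR_le_scale => //; rewrite ge_min lexx.
rewrite powRM ?(ltW h0)//.
have h0' : h != 0 by rewrite gt_eqF.
rewrite (_ : h `^ g3 * _ = F * 2 `^ (n.-1%:R - g2) * h `^ a2); last first.
  have -> : h `^ a2 = h `^ (n.-1%:R - g2) * h `^ g3.
    by rewrite -powRD// h0' implybT.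
  by ring.
rewrite -[leRHS]mulrA ler_wpM2l ?mulr_ge0 ?powR_ge0//.
by apply: powR_le_scale => //; rewrite ge_min lexx orbT.
Qed.

Lemma omega_log_ge0 (th r : R) : 0 <= omega_log th r.
Proof. by rewrite /omega_log; case: ifP => _; rewrite mulr_ge0 ?powR_ge0. Qed.

(** For h <= expR (- th^-1) the logarithm of d / h is bounded by a multiple of
    |ln h|, which is at least 1 as th <= 1; for the other h < d the left side is bounded and omega_log is
    a positive constant. *)
Lemma omega_log_dominates (th : R) : 0 < th -> th <= 1 -> exists2 k, 0 <= k &
  forall h, 0 < h -> h < d -> h `^ th * (1 + ln (d / h)) <= k * omega_log th h.
Proof.
move=> th0 th1; pose r := expR (- th^-1).
have r0 : 0 < r := expR_gt0 _.
have lnr : ln r = - th^-1 by rewrite expRK.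
pose w := r `^ th * `|ln r|.
have w0 : 0 < w.
  by rewrite mulr_gt0 ?powR_gt0// normr_gt0 lnr oppr_eq0 invr_eq0 gt_eqF.
pose k1 := 2 + `|ln d|; pose k2 := d `^ th * (1 + `|ln (d / r)|) / w.
have k10 : 0 <= k1 by rewrite addr_ge0.
have k20 : 0 <= k2 by rewrite divr_ge0 ?(ltW w0)// mulr_ge0 ?powR_ge0// addr_ge0.
exists (k1 + k2); first by rewrite addr_ge0.
move=> h h0 hd; rewrite mulrDl.
have om0 := omega_log_ge0 th h.
have [hr|hr] := leP h r.
  (* Here 1 <= th^-1 <= |ln h|. *)
  apply: ler_wpDr; first by rewrite mulr_ge0.
  rewrite /omega_log -/r hr mulrCA ler_wpM2l ?powR_ge0//.
  have lnh : ln h <= - th^-1 by rewrite -lnr ler_ln ?posrE.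
  have thV : 1 <= th^-1 by rewrite invf_ge1.
  rewrite ler0_norm; last by apply: le_trans lnh _; rewrite oppr_le0; lra.
  rewrite lnM ?posrE ?invr_gt0// lnV ?posrE// /k1.
  have lnd := ler_norm (ln d).
  have : `|ln d| <= `|ln d| * - ln h by rewrite ler_peMr//; lra.
  by lra.
apply: ler_wpDl; first by rewrite mulr_ge0.
rewrite /omega_log -/r (leNgt h r) hr /= -/w divfK ?gt_eqF//.
apply: ler_pM; rewrite ?powR_ge0//.
- by rewrite addr_ge0// ln_ge0// ler_pdivlMr// mul1r ltW.
- apply: ge0_ler_powR; [exact: ltW| | |exact: ltW].
    by rewrite nnegrE ltW.
  by rewrite nnegrE ltW.
rewrite lerD2l; apply: le_trans (ler_norm _).
rewrite ler_ln ?posrE ?divr_gt0// ler_pM2l//.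
by rewrite lef_pV2 ?posrE// ltW.
Qed.

Lemma modulus_estimate_log : g2 = n.-1%:R -> 0 < g3 -> g3 <= 1 ->
  exists2 A, 0 <= A &
    modulus_estimate A (fun h => Num.max (h `^ a) (omega_log g3 h)).
Proof.
move=> g2E g30 g31.
have Gd2 x y : G x -> G y -> enorm (x - y) < 2 * d.
  by move=> Gx Gy; apply: lt_trans (Gd Gx Gy) _; rewrite ltr_pMl// ltr1n.
have [F F0 farF] := integral_riesz_log closedG regG Gd2.
have [|x s Gx s0 sd|A A0 hA] :=
    @modulus_estimate_far (fun s => F * `|1 + ln (2 * d / s)|).
- by move=> s s0; rewrite mulr_ge0.
- rewrite g2E; apply: le_trans (farF _ _ Gx s0 sd) _.
  by rewrite lee_fin ler_wpM2l// ler_norm.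
have [k k0 dom] := omega_log_dominates g30 g31.
exists (A * (1 + F * k)); first by rewrite mulr_ge0// addr_ge0// mulr_ge0.
apply: modulus_estimate_le hA; first by rewrite mulr_ge0// addr_ge0// mulr_ge0.
move=> h h0 hd /=; rewrite -[leRHS]mulrA ler_wpM2l// [leRHS]mulrDl mul1r; apply: lerD.
  by rewrite le_max lexx.
rewrite (_ : 2 * d / (2 * h) = d / h); last by rewrite -mulf_div divff// mul1r.
rewrite ger0_norm; last by rewrite addr_ge0// ln_ge0// ler_pdivlMr// mul1r ltW.
rewrite mulrCA -[leRHS]mulrA ler_wpM2l//; apply: le_trans (dom _ h0 hd) _.
by rewrite ler_wpM2l// le_max lexx orbT.
Qed.

End moduli.

(** * Continuity of the bilinear map *)

Section target_norms.
Context {R : realType} {n : nat}.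
Local Notation E := 'rV[R]_n.
Local Notation normc := Normc.normc.
Context (G : set E).
Implicit Types (f g : E -> R[i]) (omega : R -> R).

(** An element of Z is determined by its values on G only, hence the hypothesis
    on h. *)
Definition subadditive_norm (Z : @nspace R (E -> R[i])) : Prop :=
  forall f g h, (forall x, G x -> h x = f x + g x) ->
  (nspace_norm Z h <= nspace_norm Z f + nspace_norm Z g)%E.

Lemma sup0_leD (A B D : set R) :
  (forall c, A c -> exists a b, [/\ B a, D b & c <= a + b]) ->
  (Defs.sup0 A <= Defs.sup0 B + Defs.sup0 D)%E.
Proof.
move=> h; apply: ge_ereal_sup => _ [->|[c Ac <-]].
  by rewrite adde_ge0 ?sup0_ge0.
have [a [b [Ba Db cab]]] := h c Ac.
apply: (@le_trans _ _ (a%:E + b%:E)%E); first by rewrite -EFinD lee_fin.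
by apply: leeD; exact: sup0_ub.
Qed.

Lemma sup_norm_leD f g h : (forall x, G x -> h x = f x + g x) ->
  (sup_norm G h <= sup_norm G f + sup_norm G g)%E.
Proof.
move=> hE; apply: sup0_leD => _ [x Gx <-].
exists (normc (f x)), (normc (g x)); split; [by exists x|by exists x|].
by rewrite hE// le_normcD.
Qed.

Lemma C0_space_subadditive : subadditive_norm (C0_space G).
Proof. exact: sup_norm_leD. Qed.

Lemma holder_space_subadditive omega : (forall r, 0 <= omega r) ->
  subadditive_norm (holder_space omega G).
Proof.
move=> om0 f g h hE /=; rewrite /holder_norm addeACA; apply: leeD.
  exact: sup_norm_leD.
apply: sup0_leD => _ [x [y [Gx Gy xy ->]]].
pose q (k : E -> R[i]) := normc (k x - k y) / omega (enorm (x - y)).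
exists (q f), (q g); split; [by exists x, y|by exists x, y|].
rewrite /q -mulrDl ler_wpM2r ?invr_ge0//.
by rewrite !hE// opprD addrACA le_normcD.
Qed.

Lemma sup_norm_le f (b : R) : 0 <= b -> (forall x, G x -> normc (f x) <= b) ->
  (sup_norm G f <= b%:E)%E.
Proof. by move=> b0 h; apply: sup0_le => // _ [x Gx <-]; exact: h. Qed.

Lemma holder_norm_le f omega (b c : R) : 0 <= b -> 0 <= c ->
  (forall r, 0 < r -> 0 < omega r) ->
  (forall x, G x -> normc (f x) <= b) ->
  (forall x y, G x -> G y -> x != y ->
    normc (f x - f y) <= c * omega (enorm (x - y))) ->
  (holder_norm omega G f <= (b + c)%:E)%E.
Proof.
move=> b0 c0 om0 fb fc; rewrite EFinD; apply: leeD; first exact: sup_norm_le.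
apply: sup0_le => // _ [x [y [Gx Gy xy ->]]].
by rewrite ler_pdivrMr ?fc// om0// enorm_sub_gt0.
Qed.

End target_norms.

Section bilinearity.
Context {R : realType} {n : nat}.
Local Notation E := 'rV[R]_n.
Local Notation T := (caratheodory_type (@hausdorff R n n.-1)).
Local Notation normc := Normc.normc.
Context (G : set E) (g1 g2 g3 : R) (mG : measurable (G : set T)).
Context (intG : forall K mu, kernel_space g1 g2 g3 G K -> linfty_space G mu ->
  forall x, G x -> cintegrable G (fun y => K x y * mu y)).
Implicit Types (K : E -> E -> R[i]) (mu : E -> R[i]).

Lemma kernel_norm_ge0 K : (0 <= kernel_norm g1 g2 g3 G K)%E.
Proof. by apply: adde_ge0; exact: sup0_ge0. Qed.

Lemma linfty_norm_ge0 mu : (0 <= linfty_norm G mu)%E.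
Proof. exact: Lnorm_ge0. Qed.

Lemma potential_linearl (c : R[i]) K1 K2 mu :
  kernel_space g1 g2 g3 G K1 -> kernel_space g1 g2 g3 G K2 ->
  linfty_space G mu -> forall x, G x ->
  potential G (fun x y => c * K1 x y + K2 x y) mu x =
  c * potential G K1 mu x + potential G K2 mu x.
Proof.
move=> X1 X2 Ymu x Gx; rewrite /potential.
rewrite -(cintegralZD mG c (intG X1 Ymu Gx) (intG X2 Ymu Gx)).
by congr cintegral; apply/funext => y; rewrite mulrDl mulrA.
Qed.

Lemma potential_linearr (c : R[i]) K mu1 mu2 :
  kernel_space g1 g2 g3 G K -> linfty_space G mu1 -> linfty_space G mu2 ->
  forall x, G x ->
  potential G K (fun y => c * mu1 y + mu2 y) x =
  c * potential G K mu1 x + potential G K mu2 x.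
Proof.
move=> XK Y1 Y2 x Gx; rewrite /potential.
rewrite -(cintegralZD mG c (intG XK Y1 Gx) (intG XK Y2 Gx)).
by congr cintegral; apply/funext => y; rewrite mulrDr mulrCA.
Qed.

Lemma kernel_spaceB K1 K2 :
  kernel_space g1 g2 g3 G K1 -> kernel_space g1 g2 g3 G K2 ->
  (kernel_norm g1 g2 g3 G (fun x y => (K1 x y - K2 x y)%R) < +oo)%E ->
  kernel_space g1 g2 g3 G (fun x y => K1 x y - K2 x y).
Proof.
move=> [c1 _] [c2 _] fin; split; last exact: fin.
by move=> p; apply: cvgB; [exact: c1|exact: c2].
Qed.

Lemma linfty_spaceB mu1 mu2 : linfty_space G mu1 -> linfty_space G mu2 ->
  (linfty_norm G (fun y => (mu1 y - mu2 y)%R) < +oo)%E ->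
  linfty_space G (fun y => mu1 y - mu2 y).
Proof.
move=> [m1 _] [m2 _] fin; split; last exact: fin.
exact: (cmeasurableB m1 m2).
Qed.

(** Writing K mu for the potential, K mu - K0 mu0 is the sum of
    (K - K0) (mu - mu0), (K - K0) mu0 and K0 (mu - mu0), and the bound makes the
    three terms of order d when K - K0 and mu - mu0 have norm less than
    d <= 1. *)
Lemma continuous_bilinear_of_bound (Z : @nspace R (E -> R[i])) (A : R) : 0 <= A ->
  subadditive_norm G Z ->
  (forall K mu, kernel_space g1 g2 g3 G K -> linfty_space G mu ->
    Z (potential G K mu)) ->
  (forall K mu M N, kernel_space g1 g2 g3 G K -> linfty_space G mu ->
    0 <= M -> 0 <= N ->
    (kernel_norm g1 g2 g3 G K <= M%:E)%E -> (linfty_norm G mu <= N%:E)%E ->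
    (nspace_norm Z (potential G K mu) <= (A * (M * N))%:E)%E) ->
  continuous_bilinear G (kernel_space g1 g2 g3 G) (linfty_space G) Z
    (potential G).
Proof.
move=> A0 subZ memZ bound; split.
- exact: memZ.
- exact: potential_linearl.
- exact: potential_linearr.
move=> K0 mu0 XK0 Ymu0 e e0.
pose M0 := fine (kernel_norm g1 g2 g3 G K0).
pose N0 := fine (linfty_norm G mu0).
have M00 : 0 <= M0 by rewrite fine_ge0// kernel_norm_ge0.
have N00 : 0 <= N0 by rewrite fine_ge0// linfty_norm_ge0.
have KM0 : (kernel_norm g1 g2 g3 G K0 <= M0%:E)%E.
  by rewrite fineK// ge0_fin_numE ?kernel_norm_ge0//; case: XK0.
have muN0 : (linfty_norm G mu0 <= N0%:E)%E.
  by rewrite fineK// ge0_fin_numE ?linfty_norm_ge0//; case: Ymu0.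
pose q := A * (1 + N0 + M0).
have q0 : 0 <= q by rewrite mulr_ge0// !addr_ge0.
pose d := Num.min 1 (e / (q + 1)).
have d0 : 0 < d by rewrite lt_min ltr01 divr_gt0// ltr_wpDl.
have d1 : d <= 1 by rewrite ge_min lexx.
have de : d <= e / (q + 1) by rewrite ge_min lexx orbT.
exists d; first exact: d0.
move=> K mu XK Ymu /= dK dmu.
have fin t : (t < d%:E -> t < +oo)%E by move=> /lt_le_trans; apply; exact: leey.
pose dK' x y := K x y - K0 x y; pose dmu' y := mu y - mu0 y.
have XdK : kernel_space g1 g2 g3 G dK' by exact: (kernel_spaceB XK XK0 (fin _ dK)).
have Ydmu : linfty_space G dmu' by exact: (linfty_spaceB Ymu Ymu0 (fin _ dmu)).
have b1 := bound _ _ d d XdK Ydmu (ltW d0) (ltW d0) (ltW dK) (ltW dmu).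
have b2 := bound _ _ d N0 XdK Ymu0 (ltW d0) N00 (ltW dK) muN0.
have b3 := bound _ _ M0 d XK0 Ydmu M00 (ltW d0) KM0 (ltW dmu).
have decomp x : G x -> potential G K mu x - potential G K0 mu0 x =
    potential G dK' dmu' x + (potential G dK' mu0 x + potential G K0 dmu' x).
  move=> Gx.
  have addl mu' : linfty_space G mu' ->
      potential G K mu' x = potential G dK' mu' x + potential G K0 mu' x.
    move=> Y'; rewrite -[X in X + _]mul1r -(potential_linearl 1 XdK XK0 Y' Gx).
    congr cintegral; apply/funext => y; congr (_ * _).
    by rewrite mul1r subrK.
  have addr K' : kernel_space g1 g2 g3 G K' ->
      potential G K' mu x = potential G K' dmu' x + potential G K' mu0 x.
    move=> X'; rewrite -[X in X + _]mul1r -(potential_linearr 1 X' Ydmu Ymu0 Gx).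
    congr cintegral; apply/funext => y; congr (_ * _).
    by rewrite mul1r subrK.
  rewrite (addl _ Ymu) (addr _ XdK) (addr _ XK0) -!addrA.
  by rewrite subrr addr0.
apply: le_lt_trans (subZ _ _ _ decomp) _.
apply: le_lt_trans (leeD b1 (le_trans (subZ _ _ _ (fun _ _ => erefl)) (leeD b2 b3))) _.
rewrite -!EFinD lte_fin.
apply: le_lt_trans (ltr_pMdiv1 q0 e0).
apply: (@le_trans _ _ (q * d)); last by rewrite ler_wpM2l.
have : A * (d * d) <= A * (1 * d) by rewrite ler_wpM2l// ler_wpM2r// ltW.
by rewrite /q; lra.
Qed.

End bilinearity.

Section boundary_potentials.
Context {R : realType} {n : nat}.
Local Notation E := 'rV[R]_n.
Local Notation normc := Normc.normc.

Lemma bounded_set_enorm (G : set E) : bounded_set G ->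
  exists2 d : R, 0 < d & forall x y, G x -> G y -> enorm (x - y) < d.
Proof.
move=> [M [_ GM]]; pose M1 := `|M| + 1.
have M1M : M < M1 by rewrite /M1; apply: le_lt_trans (ler_norm M) _; rewrite ltrDl.
have M10 : 0 < M1 by rewrite ltr_wpDl.
pose b := Num.sqrt n%:R * M1.
have b0 : 0 <= b by rewrite mulr_ge0 ?sqrtr_ge0// ltW.
have Gb x : G x -> enorm x <= b.
  move=> Gx; apply: le_trans (enorm_le_norm x) _.
  by rewrite ler_wpM2l ?sqrtr_ge0//; exact: (GM _ M1M).
exists (b + b + 1); first by rewrite ltr_wpDl// addr_ge0.
move=> x y Gx Gy; apply: le_lt_trans (enormD _ _) _; rewrite enormN.
by rewrite ltr_pwDr// lerD// Gb.
Qed.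

Context (G : set E) (C g1 g2 g3 : R).
Context (bG : bounded_set G) (closedG : closed G).
Context (regG : upper_regular n.-1 G C) (n2 : (2 <= n)%N).
Context (g1m : g1 < n.-1%:R).
Implicit Types (K : E -> E -> R[i]) (mu : E -> R[i]).

Lemma kernel_space_fine K : kernel_space g1 g2 g3 G K ->
  exists2 M, 0 <= M & (kernel_norm g1 g2 g3 G K <= M%:E)%E.
Proof.
move=> [_ finK]; exists (fine (kernel_norm g1 g2 g3 G K)).
  by rewrite fine_ge0// kernel_norm_ge0.
by rewrite fineK// ge0_fin_numE ?kernel_norm_ge0.
Qed.

Lemma linfty_space_fine mu : linfty_space G mu ->
  exists2 N, 0 <= N & (linfty_norm G mu <= N%:E)%E.
Proof.
move=> [_ finmu]; exists (fine (linfty_norm G mu)).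
  by rewrite fine_ge0// linfty_norm_ge0.
by rewrite fineK// ge0_fin_numE ?linfty_norm_ge0.
Qed.

Lemma potential_integrable K mu : kernel_space g1 g2 g3 G K ->
  linfty_space G mu -> forall x, G x -> cintegrable G (fun y => K x y * mu y).
Proof.
move=> XK Ymu x Gx; have [d d0 Gd] := bounded_set_enorm bG.
have [M M0 KM] := kernel_space_fine XK.
have [N N0 muN] := linfty_space_fine Ymu.
have [B B0 nearB] := integral_riesz_near closedG regG g1m.
exact: (potential_bounded closedG regG n2 XK.1 KM M0 Ymu.1 muN N0 nearB d0
  (fun y Gy => Gd y x Gy Gx) Gx).1.
Qed.

Lemma potential_within_continuous K mu : kernel_space g1 g2 g3 G K ->
  linfty_space G mu -> {within G, continuous (potential G K mu : E -> R[i]^o)}.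
Proof.
move=> XK Ymu; have [d d0 Gd] := bounded_set_enorm bG.
have [M M0 KM] := kernel_space_fine XK.
have [N N0 muN] := linfty_space_fine Ymu.
have cG := bounded_closed_compact bG closedG.
exact: (potential_continuous cG closedG regG n2 d0 Gd g1m XK.1 KM M0 Ymu.1 muN N0).
Qed.

Let mG := measurable_closed_area closedG.

Lemma potential_C0_bilinear :
  continuous_bilinear G (kernel_space g1 g2 g3 G) (linfty_space G)
    (C0_space G) (potential G).
Proof.
have [d d0 Gd] := bounded_set_enorm bG.
have [A A0 estA] := @sup_estimate_exists _ _ _ _ _ closedG regG n2 d0 Gd
  g1 g2 g3 g1m.
apply: (continuous_bilinear_of_bound mG potential_integrable A0).
- exact: C0_space_subadditive.
- exact: potential_within_continuous.
move=> K mu M N XK Ymu M0 N0 KM muN; apply: sup_norm_le.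
  by rewrite !mulr_ge0.
exact: (estA _ _ _ _ XK Ymu M0 N0 KM muN).
Qed.

Lemma potential_holder_bilinear (omega : R -> R) (A : R) :
  (forall r, 0 <= omega r) -> (forall r, 0 < r -> 0 < omega r) -> 0 <= A ->
  modulus_estimate G g1 g2 g3 A omega ->
  continuous_bilinear G (kernel_space g1 g2 g3 G) (linfty_space G)
    (holder_space omega G) (potential G).
Proof.
move=> om_ge0 om_gt0 A0 modA; have [d d0 Gd] := bounded_set_enorm bG.
have [S S0 estS] := @sup_estimate_exists _ _ _ _ _ closedG regG n2 d0 Gd
  g1 g2 g3 g1m.
have bound K mu M N : kernel_space g1 g2 g3 G K -> linfty_space G mu ->
    0 <= M -> 0 <= N ->
    (kernel_norm g1 g2 g3 G K <= M%:E)%E -> (linfty_norm G mu <= N%:E)%E ->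
    (holder_norm omega G (potential G K mu) <= ((S + A) * (M * N))%:E)%E.
  move=> XK Ymu M0 N0 KM muN; rewrite mulrDl; apply: holder_norm_le.
  - by rewrite !mulr_ge0.
  - by rewrite !mulr_ge0.
  - exact: om_gt0.
  - exact: (estS _ _ _ _ XK Ymu M0 N0 KM muN).
  - exact: (modA _ _ _ _ XK Ymu M0 N0 KM muN).
apply: (continuous_bilinear_of_bound mG potential_integrable (addr_ge0 S0 A0)).
- exact: holder_space_subadditive.
- move=> K mu XK Ymu; split; first exact: potential_within_continuous.
  have [M M0 KM] := kernel_space_fine XK.
  have [N N0 muN] := linfty_space_fine Ymu.
  by apply: le_lt_trans (bound _ _ _ _ XK Ymu M0 N0 KM muN) _; exact: ltry.
exact: bound.
Qed.

End boundary_potentials.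

Theorem proposition6p3 (R : realType) (n : nat) (Omega : set 'rV[R]_n)
    (g1 g2 g3 : R) :
  (2 <= n)%N -> bounded_set Omega -> open Omega -> lipschitz_domain Omega ->
  g1 < n%:R - 1 ->
  [/\ (forall (K : 'rV[R]_n -> 'rV[R]_n -> R[i]) (mu : 'rV[R]_n -> R[i]),
        kernel_space g1 g2 g3 (boundary Omega) K ->
        linfty_space (boundary Omega) mu ->
        (forall x, boundary Omega x ->
          cintegrable (boundary Omega) (fun y => K x y * mu y)) /\
        {within boundary Omega,
          continuous (potential (boundary Omega) K mu : 'rV[R]_n -> R[i]^o)}) /\
      continuous_bilinear (boundary Omega)
        (kernel_space g1 g2 g3 (boundary Omega))
        (linfty_space (boundary Omega))
        (C0_space (boundary Omega))
        (potential (boundary Omega)),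
      n%:R - 2 <= g1 < n%:R - 1 -> n%:R - 1 < g2 -> 0 < g3 <= 1 ->
      0 < (n%:R - 1) - g2 + g3 <= 1 ->
      continuous_bilinear (boundary Omega)
        (kernel_space g1 g2 g3 (boundary Omega))
        (linfty_space (boundary Omega))
        (holder_space
          (fun r => r `^ Num.min ((n%:R - 1) - g1) ((n%:R - 1) - g2 + g3))
          (boundary Omega))
        (potential (boundary Omega))
    & n%:R - 2 <= g1 < n%:R - 1 -> g2 = n%:R - 1 -> 0 < g3 <= 1 ->
      continuous_bilinear (boundary Omega)
        (kernel_space g1 g2 g3 (boundary Omega))
        (linfty_space (boundary Omega))
        (holder_space
          (fun r => Num.max (r `^ ((n%:R - 1) - g1)) (omega_log g3 r))
          (boundary Omega))
        (potential (boundary Omega))].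

Proof.
move=> n2 bO oO lO g1n.
have nE : n%:R - 1 = n.-1%:R :> R.
  by rewrite -[n in LHS](prednK (ltnW n2)) -natr1 addrK.
rewrite nE in g1n *.
have bG := bounded_boundary bO; have closedG := @closed_boundary _ _ Omega.
have [C regG] := lipschitz_boundary_upper_regular (ltnW n2) bO oO lO.
have [d d0 Gd] := bounded_set_enorm bG.
split.
- split; last exact: (potential_C0_bilinear g2 g3 bG closedG regG n2 g1n).
  move=> K mu XK Ymu; split.
    exact: (potential_integrable bG closedG regG n2 g1n XK Ymu).
  exact: (potential_within_continuous bG closedG regG n2 g1n XK Ymu).
- move=> _ g2n _ _.
  have [A A0 modA] := modulus_estimate_power closedG regG n2 d0 Gd g3 g1n g2n.
  apply: (potential_holder_bilinear bG closedG regG n2 g1n _ _ A0 modA).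
    by move=> r; exact: powR_ge0.
  by move=> r r0; exact: powR_gt0.
move=> _ g2n /andP[g30 g31].
have [A A0 modA] := modulus_estimate_log closedG regG n2 d0 Gd g1n g2n g30 g31.
apply: (potential_holder_bilinear bG closedG regG n2 g1n _ _ A0 modA).
  by move=> r; rewrite le_max powR_ge0.
by move=> r r0; rewrite lt_max powR_gt0.
Qed.
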